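(* Let $M(\phi,\xi,\eta,g_M)$ be a cosymplectic manifold, $(N,g_N)$ a Riemannian manifold, and $F:M\to N$ a Riemannian submersion such that $(\ker F_* )^\perp=\phi(\ker F_* )\oplus\{\xi\}$. Then $F$ is a totally geodesic map if and only if it has totally geodesic fibers.
   Context: An almost contact metric structure $(\phi,\xi,\eta,g_M)$ on an odd-dimensional manifold $M$ consists of a $(1,1)$-tensor $\phi$, a vector field $\xi$, a $1$-form $\eta$ and a Riemannian metric $g_M$ with $\phi^2=-I+\eta\otimes\xi$, $\phi\xi=0$, $\eta\circ\phi=0$, $\eta(\xi)=1$, $g_M(\phi X,\phi Y)=g_M(X,Y)-\eta(X)\eta(Y)$, $\eta(X)=g_M(X,\xi)$. It is cosymplectic if it is normal and $\eta$ and $\Phi(X,Y)=g_M(X,\phi Y)$ are closed; the structure equation is $\nabla\phi=0$, and then $\nabla\xi=0$ ($\nabla$ the Levi-Civita connection of $g_M$). A Riemannian submersion $F:(M,g_M)\to(N,g_N)$ is a smooth surjective map of maximal rank such that $F_*$ preserves the lengths of vectors in $(\ker F_* )^\perp$. Here $\{\xi\}$ denotes the line distribution spanned by $\xi$. $F$ is totally geodesic if its second fundamental form $(\nabla F_* )(X,Y)=\nabla^F_XF_*Y-F_*(\nabla_XY)$ vanishes for all $X,Y\in\Gamma(TM)$, where $\nabla^F$ is the pullback connection. Totally geodesic fibers means that all fibers $F^{-1}(q)$ are totally geodesic submanifolds of $M$. *)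

(* Defs.v *)
From HB Require Import structures.
From mathcomp Require Import all_boot all_order all_algebra.
From mathcomp Require Import all_classical all_reals all_analysis.
Set Implicit Arguments.
Unset Strict Implicit.
Unset Printing Implicit Defensive.
Import Order.TTheory GRing.Theory Num.Theory.
Import numFieldNormedType.Exports.
Local Open Scope classical_set_scope.
Local Open Scope ring_scope.

Definition iter_derive (R : realType) (V W : normedModType R) (vs : seq V)
    (f : V -> W) : V -> W :=
  foldr (fun v h => (fun x => 'D_v h x)) f vs.

(* C^oo on the open set U: Frechet differentiability of the iterated
   directional derivatives of every order makes all of them continuous. *)
Definition smooth_on (R : realType) (V W : normedModType R) (U : set V)
    (f : V -> W) : Prop :=
  forall (vs : seq V) (x : V), U x -> differentiable (iter_derive vs f) x.

(* of_coord is total; its values outside target are irrelevant. *)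
Record chart (R : realType) (n : nat) (T : topologicalType) := Chart {
  source : set T;
  target : set 'rV[R]_n;
  to_coord : T -> 'rV[R]_n;
  of_coord : 'rV[R]_n -> T;
  open_source : open source;
  open_target : open target;
  to_coord_target : forall p, source p -> target (to_coord p);
  of_coord_source : forall y, target y -> source (of_coord y);
  to_coordK : forall p, source p -> of_coord (to_coord p) = p;
  of_coordK : forall y, target y -> to_coord (of_coord y) = y;
  continuous_to_coord : {within source, continuous to_coord};
  continuous_of_coord : {within target, continuous of_coord}
}.

Definition transition (R : realType) (n : nat) (T : topologicalType)
    (c d : chart R n T) : 'rV[R]_n -> 'rV[R]_n :=
  fun y => to_coord d (of_coord c y).

(* chart_at p selects a chart around p. It is only used to identify the tangent
   space T_p M with 'rV[R]_n: a row vector v stands, at p, for the tangent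
   vector whose components in chart_at p are the entries of v. *)
Record manifold (R : realType) (n : nat) := Manifold {
  carrier :> topologicalType;
  manifold_hausdorff : hausdorff_space carrier;
  manifold_second_countable : @second_countable carrier;
  atlas : set (chart R n carrier);
  chart_at : carrier -> chart R n carrier;
  chart_at_atlas : forall p, atlas (chart_at p);
  chart_at_source : forall p, source (chart_at p) p;
  atlas_compatible : forall c d, atlas c -> atlas d ->
    smooth_on (target c `&` of_coord c @^-1` source d) (transition c d)
}.

Section Tensors.
Variables (R : realType) (m : nat) (M : manifold R m).

Definition base (p : M) : 'rV[R]_m := to_coord (chart_at p) p.

(* Row vectors are multiplied on the right by Jacobian matrices. *)
Definition tan_to (c : chart R m M) (p : M) : 'M[R]_m :=
  jacobian (transition (chart_at p) c) (base p).
Definition tan_from (c : chart R m M) (p : M) : 'M[R]_m :=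
  jacobian (transition c (chart_at p)) (to_coord c p).

(* At p, an endomorphism A of T_p M acts by v |-> v *m A, a linear form w by
   v |-> v *m w, and a bilinear form b by (u, v) |-> u *m b *m v^T. *)
Definition vector_field := M -> 'rV[R]_m.
Definition one_form := M -> 'cV[R]_m.
Definition endo_field := M -> 'M[R]_m.
Definition bilin_field := M -> 'M[R]_m.

Definition vec_rep (c : chart R m M) (X : vector_field) : 'rV[R]_m -> 'rV[R]_m :=
  fun y => let p := of_coord c y in X p *m tan_to c p.
Definition form_rep (c : chart R m M) (eta : one_form) : 'rV[R]_m -> 'cV[R]_m :=
  fun y => let p := of_coord c y in tan_from c p *m eta p.
Definition endo_rep (c : chart R m M) (phi : endo_field) : 'rV[R]_m -> 'M[R]_m :=
  fun y => let p := of_coord c y in tan_from c p *m phi p *m tan_to c p.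
Definition bilin_rep (c : chart R m M) (b : bilin_field) : 'rV[R]_m -> 'M[R]_m :=
  fun y => let p := of_coord c y in tan_from c p *m b p *m (tan_from c p)^T.

Definition smooth_vector_field (X : vector_field) : Prop :=
  forall c, atlas c -> smooth_on (target c) (vec_rep c X).
Definition smooth_one_form (eta : one_form) : Prop :=
  forall c, atlas c -> smooth_on (target c) (form_rep c eta).
Definition smooth_endo_field (phi : endo_field) : Prop :=
  forall c, atlas c -> smooth_on (target c) (endo_rep c phi).
Definition smooth_bilin_field (b : bilin_field) : Prop :=
  forall c, atlas c -> smooth_on (target c) (bilin_rep c b).

Definition ev1 (eta : one_form) (p : M) (v : 'rV[R]_m) : R := (v *m eta p) 0 0.
Definition ev2 (b : bilin_field) (p : M) (u v : 'rV[R]_m) : R :=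
  (u *m b p *m v^T) 0 0.
Definition endo_app (phi : endo_field) (X : vector_field) : vector_field :=
  fun p => X p *m phi p.

Definition dir_deriv (v : 'rV[R]_m) (f : M -> R) (p : M) : R :=
  'D_v (f \o of_coord (chart_at p)) (base p).

Definition lie_bracket (X Y : vector_field) : vector_field := fun p =>
  'D_(X p) (vec_rep (chart_at p) Y) (base p)
  - 'D_(Y p) (vec_rep (chart_at p) X) (base p).

(* The exterior derivatives carry the factors 1/2 and 1/3 for which normality
   reads [phi, phi] + 2 d eta (x) xi = 0. *)
Definition ext_d1 (eta : one_form) (X Y : vector_field) (p : M) : R :=
  2^-1 * (dir_deriv (X p) (fun q => ev1 eta q (Y q)) p
          - dir_deriv (Y p) (fun q => ev1 eta q (X q)) p
          - ev1 eta p (lie_bracket X Y p)).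

Definition ext_d2 (b : bilin_field) (X Y Z : vector_field) (p : M) : R :=
  3^-1 * (dir_deriv (X p) (fun q => ev2 b q (Y q) (Z q)) p
          + dir_deriv (Y p) (fun q => ev2 b q (Z q) (X q)) p
          + dir_deriv (Z p) (fun q => ev2 b q (X q) (Y q)) p
          - ev2 b p (lie_bracket X Y p) (Z p)
          - ev2 b p (lie_bracket Y Z p) (X p)
          - ev2 b p (lie_bracket Z X p) (Y p)).

Definition closed_one_form (eta : one_form) : Prop :=
  forall X Y, smooth_vector_field X -> smooth_vector_field Y ->
  forall p, ext_d1 eta X Y p = 0.

Definition closed_two_form (b : bilin_field) : Prop :=
  forall X Y Z, smooth_vector_field X -> smooth_vector_field Y ->
    smooth_vector_field Z ->
  forall p, ext_d2 b X Y Z p = 0.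

Definition nijenhuis (phi : endo_field) (X Y : vector_field) : vector_field :=
  fun p => endo_app phi (endo_app phi (lie_bracket X Y)) p
    + lie_bracket (endo_app phi X) (endo_app phi Y) p
    - endo_app phi (lie_bracket (endo_app phi X) Y) p
    - endo_app phi (lie_bracket X (endo_app phi Y)) p.

Definition riemannian_metric (g : bilin_field) : Prop :=
  smooth_bilin_field g /\
  forall p, (forall u v, ev2 g p u v = ev2 g p v u) /\
            (forall v, v != 0 -> 0 < ev2 g p v v).

(* Gamma^k_ij at p, relative to the coordinates of chart_at p. *)
Definition christoffel (g : bilin_field) (p : M) (i j k : 'I_m) : R :=
  let d (a b c : 'I_m) :=
    'D_(delta_mx 0 a) (fun y => bilin_rep (chart_at p) g y b c) (base p) in
  2^-1 * \sum_l invmx (g p) k l * (d i j l + d j i l - d l i j).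

Definition christoffel_term (g : bilin_field) (p : M) (u v : 'rV[R]_m) :
    'rV[R]_m :=
  \row_k \sum_i \sum_j u 0 i * v 0 j * christoffel g p i j k.

Definition levi_civita (g : bilin_field) (X Y : vector_field) : vector_field :=
  fun p => 'D_(X p) (vec_rep (chart_at p) Y) (base p)
           + christoffel_term g p (X p) (Y p).

Definition almost_contact_metric (phi : endo_field) (xi : vector_field)
    (eta : one_form) (g : bilin_field) : Prop :=
  [/\ smooth_endo_field phi, smooth_vector_field xi, smooth_one_form eta,
      riemannian_metric g &
  forall p : M,
    [/\ forall u, u *m phi p *m phi p = - u + ev1 eta p u *: xi p,
        xi p *m phi p = 0,
        forall u, ev1 eta p (u *m phi p) = 0,
        ev1 eta p (xi p) = 1 &
        (forall u v, ev2 g p (u *m phi p) (v *m phi p)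
                     = ev2 g p u v - ev1 eta p u * ev1 eta p v) /\
        (forall u, ev1 eta p u = ev2 g p u (xi p))]].

Definition normal_structure (phi : endo_field) (xi : vector_field)
    (eta : one_form) : Prop :=
  forall X Y, smooth_vector_field X -> smooth_vector_field Y ->
  forall p, nijenhuis phi X Y p + (2 * ext_d1 eta X Y p) *: xi p = 0.

(* Phi(X, Y) = g(X, phi Y) *)
Definition fundamental_form (phi : endo_field) (g : bilin_field) : bilin_field :=
  fun p => g p *m (phi p)^T.

Definition cosymplectic (phi : endo_field) (xi : vector_field)
    (eta : one_form) (g : bilin_field) : Prop :=
  [/\ almost_contact_metric phi xi eta g, normal_structure phi xi eta,
      closed_one_form eta & closed_two_form (fundamental_form phi g)].

End Tensors.

Section Maps.
Variables (R : realType) (m n : nat) (M : manifold R m) (N : manifold R n).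

Definition smooth_map (F : M -> N) : Prop :=
  continuous F /\
  forall c d, atlas c -> atlas d ->
    smooth_on (target c `&` (F \o of_coord c) @^-1` source d)
      (to_coord d \o F \o of_coord c).

(* F_* at p acts by v |-> v *m tangent_map F p. *)
Definition tangent_map (F : M -> N) (p : M) : 'M[R]_(m, n) :=
  jacobian (to_coord (chart_at (F p)) \o F \o of_coord (chart_at p)) (base p).

(* Subspaces of T_p M are row spaces of matrices. *)
Definition vertical (F : M -> N) (p : M) : 'M[R]_m := kermx (tangent_map F p).

Definition horizontal (g : bilin_field M) (F : M -> N) (p : M) : 'M[R]_m :=
  kermx (g p *m (vertical F p)^T).

Definition riemannian_submersion (gM : bilin_field M) (gN : bilin_field N)
    (F : M -> N) : Prop :=
  [/\ smooth_map F,
      forall q, exists p, F p = q,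
      forall p, \rank (tangent_map F p) = n &
      forall p (u : 'rV[R]_m), (u <= horizontal gM F p)%MS ->
        ev2 gN (F p) (u *m tangent_map F p) (u *m tangent_map F p)
        = ev2 gM p u u].

(* W p is a tangent vector of N at F p. *)
Definition field_along := M -> 'rV[R]_n.

Definition along_rep (F : M -> N) (c : chart R m M) (d : chart R n N)
    (W : field_along) : 'rV[R]_m -> 'rV[R]_n :=
  fun y => let p := of_coord c y in W p *m tan_to d (F p).

Definition push (F : M -> N) (X : vector_field M) : field_along :=
  fun p => X p *m tangent_map F p.

(* In coordinates, (nabla^F_X W)^k
   = X(W^k) + (Gamma^k_ij o F) (F_* X)^i W^j, Gamma those of (N, gN). *)
Definition pullback_connection (gN : bilin_field N) (F : M -> N)
    (X : vector_field M) (W : field_along) : field_along :=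
  fun p => 'D_(X p) (along_rep F (chart_at p) (chart_at (F p)) W) (base p)
           + christoffel_term gN (F p) (push F X p) (W p).

Definition second_fundamental_form (gM : bilin_field M) (gN : bilin_field N)
    (F : M -> N) (X Y : vector_field M) : field_along :=
  fun p => pullback_connection gN F X (push F Y) p
           - push F (levi_civita gM X Y) p.

Definition totally_geodesic_map (gM : bilin_field M) (gN : bilin_field N)
    (F : M -> N) : Prop :=
  forall X Y, smooth_vector_field X -> smooth_vector_field Y ->
  forall p, second_fundamental_form gM gN F X Y p = 0.

(* The tangent space at p of the fibre through p is vertical F p. *)
Definition tangent_to_fiber (F : M -> N) (q : N) (X : vector_field M) : Prop :=
  forall p, F p = q -> (X p <= vertical F p)%MS.

(* A submanifold S is totally geodesic when its second fundamental form, the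
   normal part of nabla_X Y for X, Y tangent to S, vanishes. The fields are
   taken on M, as every field on a closed submanifold extends to M. *)
Definition totally_geodesic_fiber (gM : bilin_field M) (F : M -> N) (q : N) :
    Prop :=
  forall X Y, smooth_vector_field X -> smooth_vector_field Y ->
    tangent_to_fiber F q X -> tangent_to_fiber F q Y ->
    tangent_to_fiber F q (levi_civita gM X Y).

Definition totally_geodesic_fibers (gM : bilin_field M) (F : M -> N) : Prop :=
  forall q, totally_geodesic_fiber gM F q.

End Maps.

(* Main.v *)
(* On a cosymplectic manifold phi and xi are parallel.  Let h be the pullback of
   gN by F and II the second fundamental form of F; II is symmetric.  The splitting
   of the horizontal distribution gives h(phi u, v) - h(u, phi v) = g(phi u, v) and
   h(u, xi) = g(u, xi), and h <= g with equality on horizontal vectors.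
   Differentiating these covariantly, where
     (nabla_x h)(u, v) = gN(II(x, u), F_* v) + gN(F_* u, II(x, v)),
   shows that phi is symmetric for nabla_x h, which kills xi and pairs of horizontal
   vectors; with the symmetry of II this forces II(x, u) = 0 for horizontal x.
   Hence F is totally geodesic iff II vanishes on vertical pairs.  For fields U, V
   tangent to a fibre, II(U, V) = - F_* (nabla_U V) along that fibre, and every
   vertical vector extends to a smooth vertical field, namely u (det g - h adj g)
   in coordinates, cut off by a bump function. *)
Require Import Defs.
From HB Require Import structures.
From mathcomp Require Import all_boot all_order all_algebra.
From mathcomp Require Import all_classical all_reals all_analysis.
From mathcomp Require Import ring lra.
Set Implicit Arguments.
Unset Strict Implicit.
Unset Printing Implicit Defensive.
Import Order.TTheory GRing.Theory Num.Theory.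
Import numFieldNormedType.Exports.
Local Open Scope classical_set_scope.
Local Open Scope ring_scope.

(** * Differential calculus of matrix-valued maps *)

(** Everything is computed at one point p, with the first derivatives of the coefficient matrices as
    named unknowns, so that only linear algebra with Christoffel symbols remains. Since [chart_at]
    may jump from point to point, quantities expressed through it cannot be differentiated directly;
    each field is first rewritten in the fixed charts at p and F p. Horizontal vectors are handled
    through h <= g: for w horizontal at p and constant in coordinates, g(w, w) - h(w, w) has a
    minimum with value 0 at p, so its derivative there vanishes. A further obstacle is that a field
    Y tangent to one fibre has F_* Y = 0 on that fibre only. To differentiate this along a vertical
    vector, the fibre must contain points in that direction up to first order; [derive_level_set]
    produces them by a minimisation on a compact ball, in place of the implicit function theorem.
    The factor det g in the vertical field clears the denominator of the vertical projection 1 - h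
    g^-1, so that the field is polynomial in smooth coefficients. *)

Section Differentials.
Variable R : realType.
Implicit Types V W : normedModType R.

Lemma diff_near V W (f g : V -> W) x :
  (\near x, f x = g x) -> differentiable f x ->
  differentiable g x /\ 'd g x = 'd f x :> (V -> W).
Proof.
move=> fg df; have [dc dfx] := (diff_locallyP _ _).1 df.
have fg0 : \forall h \near 0, f (h + x) = g (h + x).
  by move: fg; rewrite (near_shift 0 x) subr0.
have gdf : g \o shift x = cst (g x) + 'd f x +o_ 0 id.
  apply/eqaddoP => _/posnumP[e]; near=> h.
  have -> : (g \o shift x - (cst (g x) + 'd f x)) h
      = (f \o shift x - (cst (f x) + 'd f x)) h.
    rewrite !fctE /= (nbhs_singleton fg); congr (_ - _); apply/esym.
    by near: h; exact: fg0.
  by near: h; apply: ((eqaddoP _ _ _ _).1 dfx); exact: gt0.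
have dg : 'd g x = 'd f x :> (V -> W) by apply: diff_unique.
split; last exact: dg.
apply: (diff_locallyP _ _).2.
exact: (eq_ind_r (fun h => continuous h /\ g \o shift x = cst (g x) + h +o_ 0 id)
  (conj dc gdf) dg).
Unshelve. all: by end_near. Qed.

Lemma differentiable_near V W (f g : V -> W) x :
  (\near x, f x = g x) -> differentiable f x -> differentiable g x.
Proof. by move=> fg /(diff_near fg)[]. Qed.

Lemma differentiable_comp_derive V W (W' : normedModType R) (f : V -> W)
    (g : W -> W') x v : differentiable f x -> differentiable g (f x) ->
  'D_v (g \o f) x = 'D_('D_v f x) g (f x).
Proof.
move=> df dg; rewrite !deriveE//; last exact: differentiable_comp.
by rewrite diff_comp.
Qed.

Lemma differentiable_mx V m n (f : V -> 'M[R]_(m, n)) x :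
  (forall i j, differentiable (fun y => f y i j) x) -> differentiable f x.
Proof.
move=> df.
have -> : f = fun y => \sum_i (\sum_j (f y i j *: delta_mx i j)).
  by apply/funext => y; rewrite [LHS]matrix_sum_delta.
have -> : (fun y => \sum_i (\sum_j (f y i j *: delta_mx i j)))
    = \sum_i (\sum_j ((fun y => f y i j *: delta_mx i j) : V -> 'M[R]_(m, n))).
  apply/funext => y; rewrite fct_sumE; apply: eq_bigr => i _.
  by rewrite fct_sumE.
apply: (differentiable_sum (f := fun i => \sum_j _)) => i.
apply: (differentiable_sum (f := fun j => fun y => f y i j *: delta_mx i j)) => j.
exact: differentiableZl.
Qed.

Lemma differentiable_coordE V m n (f : V -> 'M[R]_(m, n)) x i j :
  differentiable f x -> differentiable (fun y => f y i j) x.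
Proof.
move=> df; have dc := differentiable_coord (f x) i j.
by have := differentiable_comp df dc.
Qed.

Lemma derive_coord V m n (f : V -> 'M[R]_(m, n)) x v i j :
  differentiable f x -> 'D_v (fun y => f y i j) x = 'D_v f x i j.
Proof.
by move=> df; rewrite derive_mx ?mxE//; exact: diff_derivable.
Qed.

Lemma derive_linear V W (f : V -> W) x (a : R) u v : differentiable f x ->
  'D_(a *: u + v) f x = a *: 'D_u f x + 'D_v f x.
Proof. by move=> df; rewrite !deriveE// linearP. Qed.

Lemma derive_row_sum W m (f : 'rV[R]_m -> W) x v : differentiable f x ->
  'D_v f x = \sum_i v 0 i *: 'D_(delta_mx 0 i) f x.
Proof.
move=> df; rewrite deriveE// {1}(row_sum_delta v) linear_sum.
by apply: eq_bigr => i _; rewrite linearZ deriveE.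
Qed.

Lemma differentiable_mulmx V m n p (A : V -> 'M[R]_(m, n))
    (B : V -> 'M[R]_(n, p)) x : differentiable A x -> differentiable B x ->
  differentiable (fun y => A y *m B y) x.
Proof.
move=> dA dB; apply: differentiable_mx => i j.
have -> : (fun y => (A y *m B y) i j)
    = \sum_k ((fun y => A y i k) * (fun y => B y k j)).
  by apply/funext => y; rewrite fct_sumE mxE.
apply: differentiable_sum => k.
by apply: differentiableM; exact: differentiable_coordE.
Qed.

Lemma derive_mulmx V m n p (A : V -> 'M[R]_(m, n))
    (B : V -> 'M[R]_(n, p)) x v : differentiable A x -> differentiable B x ->
  'D_v (fun y => A y *m B y) x = 'D_v A x *m B x + A x *m 'D_v B x.
Proof.
move=> dA dB; apply/matrixP => i j.
rewrite -derive_coord; last exact: differentiable_mulmx.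
have -> : (fun y => (A y *m B y) i j)
    = \sum_k ((fun y => A y i k) * (fun y => B y k j)).
  by apply/funext => y; rewrite fct_sumE mxE.
have dM k : derivable ((fun y => A y i k) * (fun y => B y k j)) x v.
  apply: diff_derivable.
  by apply: differentiableM; exact: differentiable_coordE.
rewrite derive_sum// !mxE -big_split/=; apply: eq_bigr => k _.
rewrite deriveM; try by apply: diff_derivable; exact: differentiable_coordE.
by rewrite -!derive_coord// addrC; congr (_ + _); exact: mulrC.
Qed.

Lemma derive_trmx V m n (A : V -> 'M[R]_(m, n)) x v : differentiable A x ->
  'D_v (fun y => (A y)^T) x = ('D_v A x)^T.
Proof.
move=> dA; have dT : differentiable (fun y => (A y)^T) x.
  apply: differentiable_mx => i j.
  have -> : (fun y => (A y)^T i j) = fun y => A y j i.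
    by apply/funext => y; rewrite mxE.
  exact: differentiable_coordE.
apply/matrixP => i j; rewrite -derive_coord// mxE -derive_coord//.
by congr ('D_v _ x); apply/funext => y; rewrite mxE.
Qed.

Lemma differentiable_trmx V m n (A : V -> 'M[R]_(m, n)) x :
  differentiable A x -> differentiable (fun y => (A y)^T) x.
Proof.
move=> dA; apply: differentiable_mx => i j.
have -> : (fun y => (A y)^T i j) = fun y => A y j i.
  by apply/funext => y; rewrite mxE.
exact: differentiable_coordE.
Qed.

Lemma jacobian_near m n (f g : 'rV[R]_m -> 'rV[R]_n) x :
  (\near x, f x = g x) -> differentiable f x -> jacobian f x = jacobian g x.
Proof.
move=> fg df; have [dg dgf] := diff_near fg df.
exact: (congr1 (@lin1_mx R m n) (esym dgf)).
Qed.

Lemma jacobian_comp m n p (f : 'rV[R]_m -> 'rV[R]_n) (g : 'rV[R]_n -> 'rV[R]_p) x :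
  differentiable f x -> differentiable g (f x) ->
  jacobian (g \o f) x = jacobian f x *m jacobian g (f x).
Proof.
move=> df dg; apply/row_matrixP => i; rewrite !rowE -deriveEjacobian//.
  by rewrite differentiable_comp_derive// !deriveEjacobian// mulmxA.
exact: differentiable_comp.
Qed.

Lemma jacobian_id m (x : 'rV[R]_m) : jacobian id x = 1%:M.
Proof.
by apply/row_matrixP => i; rewrite !rowE -deriveEjacobian// derive_id mulmx1.
Qed.

Section Line.
Variables (V : normedModType R) (x v : V).
Let k (t : R) : V := t *: v + x.

Lemma differentiable_line t : differentiable k t.
Proof.
by apply: differentiableD => //; exact: (differentiableZl v).
Qed.

Lemma derive_line t : 'D_1 k t = v.
Proof.
have dv : differentiable (fun t : R => t *: v) t by exact: (differentiableZl v).
rewrite /k deriveD//; last by apply: diff_derivable.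
by rewrite derive_cst addr0 deriveE// diffZl// diff_val scale1r.
Qed.

Lemma line_near (P : set V) : nbhs x P -> \forall t \near 0, P (k t).
Proof.
have kx : k 0 = x by rewrite /k scale0r add0r.
rewrite -{1}kx; exact: (differentiable_continuous (differentiable_line 0)).
Qed.
End Line.

(** Fermat's criterion on the line through [x] with direction [v]. It serves twice: for the squared
    distance inside the bump function, and for the difference of the two metrics on a horizontal
    vector. *)
Lemma derive_min0 V (f : V -> R) x v : (\near x, differentiable f x) ->
  (\near x, 0 <= f x) -> f x = 0 -> 'D_v f x = 0.
Proof.
move=> df fge f0; pose k (t : R) := t *: v + x.
have kx : k 0 = x by rewrite /k scale0r add0r.
have [e /= e0 ke] : \forall t \near 0, differentiable f (k t) /\ 0 <= f (k t).
  apply: (@line_near _ x v [set y | differentiable f y /\ 0 <= f y]).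
  exact: filterI.
have {}ke t : t \in `]-e, e[ -> differentiable f (k t) /\ 0 <= f (k t).
  move=> te; apply: ke; rewrite /= sub0r normrN ltr_norml.
  by move: te; rewrite in_itv.
have /= [_] : is_derive (0 : R) 1 (f \o k) 0.
  apply: (@derive1_at_min _ _ (-e) e) => [|t te||t te].
  - by rewrite ge0_cp ?ltW.
  - apply: diff_derivable; apply: differentiable_comp; last exact: (ke _ te).1.
    exact: differentiable_line.
  - by rewrite in_itv/= oppr_lt0 e0.
  - by rewrite /= kx f0; exact: (ke _ te).2.
have dk : differentiable k 0 := differentiable_line x v 0.
have Dk : 'D_1 k 0 = v := derive_line x v 0.
have dfx : differentiable f (k 0) by rewrite kx; exact: nbhs_singleton df.
by rewrite (differentiable_comp_derive _ dk dfx) Dk kx.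
Unshelve. all: by end_near. Qed.

End Differentials.

(** * Finite orders of smoothness, stable under matrix operations and composition *)

Section Smoothness.
Variable R : realType.
Implicit Types V W : normedModType R.

(** Order 0 already asks for differentiability, so the index is one below the number of derivatives
    that exist. In particular [Ck 1] makes the first derivatives differentiable, hence
    continuous. *)
Fixpoint Ck V W (n : nat) (U : set V) (f : V -> W) : Prop :=
  (forall x, U x -> differentiable f x) /\
  (if n is n'.+1 then forall v, Ck n' U (fun x => 'D_v f x) else True).

Lemma Ck_diff V W n (U : set V) (f : V -> W) x :
  Ck n U f -> U x -> differentiable f x.
Proof. by case: n => [|n] [+ _]; apply. Qed.

Lemma CkW V W n (U : set V) (f : V -> W) : Ck n.+1 U f -> Ck n U f.
Proof.
elim: n f => [|n IH] f [df Df]; first by split.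
by split=> // v; exact: IH (Df v).
Qed.

Lemma Ck_eq V W n (U : set V) (f g : V -> W) : open U ->
  (forall x, U x -> f x = g x) -> Ck n U f -> Ck n U g.
Proof.
move=> oU; have oUx x : U x -> nbhs x U by move=> Ux; exact: open_nbhs_nbhs.
have fg_near (f1 g1 : V -> W) x : (forall x, U x -> f1 x = g1 x) -> U x ->
    \near x, f1 x = g1 x.
  by move=> fg1 Ux; apply: filterS (oUx x Ux).
elim: n f g => [|n IH] f g fg [df Df];
  have dg x (Ux : U x) : differentiable g x
    by [apply: differentiable_near (df x Ux); exact: fg_near];
  split => // v.
by apply: (IH _ _ _ (Df v)) => x Ux; apply: near_eq_derive; exact: fg_near.
Qed.

(** Differentiability is a condition at each point, so the witnessing set may vary with the point.
    This glues the two descriptions of a cut-off field, inside and outside the support of the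
    bump. *)
Lemma Ck_local V W n (U : set V) (f : V -> W) :
  (forall x, U x -> exists2 U', U' x & Ck n U' f) -> Ck n U f.
Proof.
elim: n f => [|n IH] f H;
  have df x (Ux : U x) : differentiable f x
    by [have [U' U'x Cf] := H x Ux; exact: Ck_diff Cf U'x];
  split => // v.
by apply: IH => x /H[U' U'x [_ Df]]; exists U'; last exact: Df.
Qed.

Lemma Ck_sub V W n (U U' : set V) (f : V -> W) : U' `<=` U ->
  Ck n U f -> Ck n U' f.
Proof. by move=> UU' Cf; apply: Ck_local => x /UU' Ux; exists U. Qed.

(** [Ck] peels off the innermost derivative, which in [iter_derive] is the last vector of the list;
    hence the use of [rcons]. *)
Lemma smooth_onE V W (U : set V) (f : V -> W) :
  smooth_on U f <-> forall n, Ck n U f.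
Proof.
split=> [+ n|Cf vs].
  elim: n f => [|n IH] f sf; (split; first exact: (sf [::])) => // v.
  apply: IH => vs x Ux; have := sf (rcons vs v) x Ux.
  by rewrite /iter_derive foldr_rcons.
elim/last_ind: vs f Cf => [|vs v IH] f Cf x Ux; first exact: (Cf 0%N).1.
rewrite /iter_derive foldr_rcons; apply: IH => // n.
exact: (Cf n.+1).2.
Qed.

Lemma Ck_cst V W n (U : set V) (a : W) : Ck n U (fun=> a).
Proof.
elim: n a => [|n IH] a; split => // v.
by have -> : 'D_v (fun=> a) = (fun=> 0) :> (V -> W)
  by apply/funext => x; exact: derive_cst.
Qed.

Lemma CkD V W n (U : set V) (f g : V -> W) : open U ->
  Ck n U f -> Ck n U g -> Ck n U (fun x => f x + g x).
Proof.
move=> oU; elim: n f g => [|n IH] f g [df Df] [dg Dg];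
  (split; first by move=> x Ux; apply: differentiableD; [exact: df|exact: dg]) => // v.
apply: (Ck_eq oU _ (IH _ _ (Df v) (Dg v))) => x Ux.
by rewrite deriveD//; apply: diff_derivable; [exact: df|exact: dg].
Qed.

Lemma CkM V n (U : set V) (f g : V -> R) : open U ->
  Ck n U f -> Ck n U g -> Ck n U (fun x => f x * g x).
Proof.
move=> oU; elim: n f g => [|n IH] f g Cf Cg; have [df Df] := Cf; have [dg Dg] := Cg;
  (split; first by move=> x Ux; apply: differentiableM; [exact: df|exact: dg]) => // v.
apply: (Ck_eq oU _ (CkD oU (IH _ _ (CkW Cf) (Dg v)) (IH _ _ (CkW Cg) (Df v)))).
by move=> x Ux; rewrite deriveM//; apply: diff_derivable; [exact: df|exact: dg].
Qed.

Lemma Ck_sum V W n (U : set V) I r (P : pred I) (F : I -> V -> W) : open U ->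
  (forall i, Ck n U (F i)) -> Ck n U (fun x => \sum_(i <- r | P i) F i x).
Proof.
move=> oU CF; elim: r => [|i r IH].
  by under [fun x => _]eq_fun do rewrite big_nil; exact: Ck_cst.
under [fun x => _]eq_fun do rewrite big_cons.
by case: (P i) => //; exact: CkD.
Qed.

Lemma Ck_prod V n (U : set V) I r (P : pred I) (F : I -> V -> R) : open U ->
  (forall i, Ck n U (F i)) -> Ck n U (fun x => \prod_(i <- r | P i) F i x).
Proof.
move=> oU CF; elim: r => [|i r IH].
  by under [fun x => _]eq_fun do rewrite big_nil; exact: Ck_cst.
under [fun x => _]eq_fun do rewrite big_cons.
by case: (P i) => //; exact: CkM.
Qed.

Lemma Ck_mx V n p q (U : set V) (f : V -> 'M[R]_(p, q)) : open U ->
  (forall i j, Ck n U (fun x => f x i j)) -> Ck n U f.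
Proof.
move=> oU; elim: n f => [|n IH] f Cf;
 have df x (Ux : U x) : differentiable f x
  by [apply: differentiable_mx => i j; exact: Ck_diff (Cf i j) Ux]; split => // v.
apply: IH => i j; apply: Ck_eq oU _ ((Cf i j).2 v) => x Ux.
by rewrite derive_coord//; exact: df.
Qed.

Lemma Ck_coord V n p q (U : set V) (f : V -> 'M[R]_(p, q)) i j : open U ->
  Ck n U f -> Ck n U (fun x => f x i j).
Proof.
move=> oU; elim: n f => [|n IH] f [df Df];
  (split; first by move=> x Ux; apply: differentiable_coordE; exact: df) => // v.
apply: Ck_eq oU _ (IH _ (Df v)) => x Ux.
by rewrite derive_coord//; exact: df.
Qed.

Lemma Ck_mulmx V n p q r (U : set V) (f : V -> 'M[R]_(p, q))
    (g : V -> 'M[R]_(q, r)) : open U ->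
  Ck n U f -> Ck n U g -> Ck n U (fun x => f x *m g x).
Proof.
move=> oU Cf Cg; apply: Ck_mx => // i j.
under [fun x => _]eq_fun do rewrite mxE.
by apply: Ck_sum => // k; apply: CkM => //; exact: Ck_coord.
Qed.

Lemma Ck_trmx V n p q (U : set V) (f : V -> 'M[R]_(p, q)) : open U ->
  Ck n U f -> Ck n U (fun x => (f x)^T).
Proof.
move=> oU Cf; apply: Ck_mx => // i j.
by under [fun x => _]eq_fun do rewrite mxE; exact: Ck_coord.
Qed.

Lemma Ck_scalemx V n p q (U : set V) (k : V -> R) (f : V -> 'M[R]_(p, q)) :
  open U -> Ck n U k -> Ck n U f -> Ck n U (fun x => k x *: f x).
Proof.
move=> oU Ck Cf; apply: Ck_mx => // i j.
under [fun x => _]eq_fun do rewrite mxE.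
by apply: CkM => //; exact: Ck_coord.
Qed.

Lemma Ck_det V n p (U : set V) (f : V -> 'M[R]_p) : open U ->
  Ck n U f -> Ck n U (fun x => \det (f x)).
Proof.
move=> oU Cf; apply: Ck_sum => // s; apply: CkM => //; first exact: Ck_cst.
by apply: Ck_prod => // i; exact: Ck_coord.
Qed.

(** The adjugate stands in for the inverse matrix: being polynomial in the entries, it is smooth
    without any division. *)
Lemma Ck_adjugate V n p (U : set V) (f : V -> 'M[R]_p) : open U ->
  Ck n U f -> Ck n U (fun x => \adj (f x)).
Proof.
move=> oU Cf; apply: Ck_mx => // i j.
under [fun x => _]eq_fun do rewrite mxE.
apply: CkM => //; first exact: Ck_cst.
apply: Ck_det => //; apply: Ck_mx => // i' j'.
by under [fun x => _]eq_fun do rewrite !mxE; exact: Ck_coord.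
Qed.

(** The chain rule is expanded over the partial derivatives of [g]. Each summand is then a product
    of scalar functions, one of them a composition with the same [f], and the induction closes. *)
Lemma Ck_comp V n p (U : set V) (U' : set 'rV[R]_p) (f : V -> 'rV[R]_p)
    (g : 'rV[R]_p -> R) : open U -> (forall x, U x -> U' (f x)) ->
  Ck n U f -> Ck n U' g -> Ck n U (g \o f).
Proof.
move=> oU fU; elim: n g => [|n IH] g Cf Cg;
 have df x (Ux : U x) : differentiable f x by [exact: Ck_diff Cf Ux];
 have dg x (Ux : U x) : differentiable g (f x) by [exact: Ck_diff Cg (fU x Ux)];
  (split; first by move=> x Ux; apply: differentiable_comp; [exact: df|exact: dg]) => // v.
pose h i (x : V) : R := ('D_v f x) 0 i * 'D_(delta_mx 0 i) g (f x).
apply: (@Ck_eq _ _ _ _ (fun x => \sum_i h i x) _ oU).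
  move=> x Ux; rewrite differentiable_comp_derive//; last 2 first.
  - exact: df.
  - exact: dg.
  by rewrite derive_row_sum//; exact: dg.
apply: Ck_sum => // i; apply: CkM => //.
  by apply: Ck_coord => //; exact: Cf.2.
by apply: (IH (fun y => 'D_(delta_mx 0 i) g y)); [exact: CkW|exact: Cg.2].
Qed.

Lemma Ck_comp_mx V n p q r (U : set V) (U' : set 'rV[R]_p) (f : V -> 'rV[R]_p)
    (g : 'rV[R]_p -> 'M[R]_(q, r)) : open U -> open U' ->
  (forall x, U x -> U' (f x)) ->
  Ck n U f -> Ck n U' g -> Ck n U (g \o f).
Proof.
move=> oU oU' fU Cf Cg; apply: Ck_mx => // i j.
by apply: (Ck_comp oU fU Cf (g := fun y => g y i j)); exact: Ck_coord.
Qed.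

Lemma Ck_jacobian n p q (U : set 'rV[R]_p) (f : 'rV[R]_p -> 'rV[R]_q) :
  open U -> Ck n.+1 U f -> Ck n U (jacobian f).
Proof.
move=> oU Cf; apply: Ck_mx => // i j.
apply: (Ck_eq oU _ (Ck_coord 0 j oU (Cf.2 (delta_mx 0 i)))) => x Ux.
have df := Ck_diff Cf Ux.
by rewrite (deriveEjacobian _ df) -rowE mxE.
Qed.

Lemma Ck_id n p (U : set 'rV[R]_p) : Ck n U id.
Proof.
case: n => [|n]; split => // v.
have -> : 'D_v id = (fun=> v) :> ('rV[R]_p -> 'rV[R]_p); last exact: Ck_cst.
by apply/funext => x; rewrite derive_id.
Qed.

End Smoothness.

(** * Smooth bump functions *)

Section FlatFunction.
Variable R : realType.
Implicit Types P : {poly R}.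

(** With y = x / n, this is the n-th power of y <= 1 + y <= exp y. *)
Lemma exprn_expR_le (n : nat) (x : R) : 0 <= x ->
  x ^+ n * expR (- x) <= n%:R ^+ n.
Proof.
move=> x0; case: n => [|n]; first by rewrite !expr0 mul1r -expR0 ler_expR oppr_le0.
rewrite expRN ler_pdivrMr ?expR_gt0//.
have n0 : 0 < n.+1%:R :> R by rewrite ltr0n.
have xE : x = x / n.+1%:R * n.+1%:R by rewrite divfK// gt_eqF.
have y0 : 0 <= x / n.+1%:R by rewrite divr_ge0// ltW.
move: y0 xE; set y := x / _ => y0 ->.
rewrite expRM_natr -exprMn lerXn2r ?nnegrE ?mulr_ge0 ?expR_ge0 ?(ltW n0)//.
rewrite mulrC ler_pM2l//; apply: le_trans (expR_ge1Dx _).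
by rewrite lerDr.
Qed.

Lemma horner_expR_le P : exists2 C : R, 0 < C &
  forall x : R, 0 <= x -> `|P.[x] * expR (- x)| <= C.
Proof.
exists (\sum_(i < size P) `|P`_i| * i%:R ^+ i + 1).
  by rewrite ltr_wpDl// sumr_ge0// => i _; rewrite mulr_ge0 ?exprn_ge0.
move=> x x0; rewrite horner_coef mulr_suml.
apply: le_trans (ler_norm_sum _ _ _) _.
apply: ler_wpDr => //; apply: ler_sum => i _.
rewrite -mulrA normrM ler_wpM2l// ger0_norm ?exprn_expR_le//.
by rewrite mulr_ge0 ?exprn_ge0 ?expR_ge0.
Qed.

(** The function exp(-1/t) extended by 0, with a polynomial in 1/t as factor: the factor closes the
    family under differentiation, so one induction reaches every order. *)
Definition flat P (t : R) : R := if 0 < t then P.[t^-1] * expR (- t^-1) else 0.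

Lemma is_derive_flat P (t : R) : is_derive t 1 (flat P) (flat ('X^2 * (P - P^`())) t).
Proof.
case: (ltgtP t 0) => [t0|t0|->].
- rewrite {2}/flat ltNge (ltW t0)/=.
  have d0 : is_derive t 1 (cst 0 : R -> R) 0 := is_derive_cst _ _ _.
  apply: (near_eq_is_derive _ d0).
  by near=> s; rewrite /flat ltNge ltW//; near: s; exact: lt_nbhsl.
- rewrite {2}/flat t0.
  pose f (s : R) := P.[s^-1] * expR (- s^-1).
  have tn0 : t != 0 by rewrite gt_eqF.
  have ff : \near t, f t = flat P t.
    by near=> s; rewrite /flat ifT//; near: s; exact: lt_nbhsr.
  apply: (near_eq_is_derive ff).
  have dV : is_derive t 1 (fun s : R => s^-1) (- t ^- 2).
    have := is_deriveV tn0 (is_derive_id t 1).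
    by rewrite /GRing.scale/= mulr1.
  have dP : is_derive t 1 (fun s : R => P.[s^-1]) (- t ^- 2 * P^`().[t^-1]).
    have H := is_derive1_comp (is_derive_poly P t^-1) dV.
    by move: H; rewrite mulrC.
  have dE : is_derive t 1 (fun s : R => expR (- s^-1)) (t ^- 2 * expR (- t^-1)).
    have dN : is_derive t 1 (fun s : R => - s^-1) (- - t ^- 2) by exact: is_deriveN.
    have H := @is_derive1_comp _ expR (fun s : R => - s^-1) _ _ _
      (is_derive_expR (- t^-1)) dN.
    by move: H; rewrite opprK mulrC.
  have H := is_deriveM dP dE.
  apply: is_derive_eq H _.
  rewrite !hornerE /GRing.scale/= -exprVn; ring.
(* At 0 the bound is taken for X^2 P instead of P: the extra factor gives |flat P s| <= C s^2, so
   the difference quotient tends to 0. *)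
- have [C C0 HC] := horner_expR_le ('X^2 * P).
  have f0 Q : flat Q 0 = 0 by rewrite /flat ltxx.
  have fle s : `|flat P s| <= C * s ^+ 2.
    rewrite /flat; case: ltP => s0; last by rewrite normr0 mulr_ge0 ?sqr_ge0// ltW.
    have sV : 0 <= s^-1 by rewrite invr_ge0 ltW.
    have H := HC _ sV; rewrite hornerM !hornerE -mulrA normrM ger0_norm ?exprn_ge0// in H.
    have := ler_wpM2l (sqr_ge0 s) H; rewrite [leLHS]mulrA.
    suff -> : s ^+ 2 * s^-1 ^+ 2 = 1 by rewrite mul1r [leRHS]mulrC.
    by rewrite -exprMn divff ?expr1n// gt_eqF.
  have cv : (h^-1 *: ((flat P \o shift 0) (h *: (1 : R)) - flat P 0) @[h --> 0^']) --> (0 : R).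
    apply/cvgrPdist_le => /= e e0; near=> h.
    rewrite f0 subr0 sub0r normrN addr0 /GRing.scale/= mulr1 normrM normfV.
    have h0 : h != 0 by near: h; exact: nbhs_dnbhs_neq.
    rewrite mulrC ler_pdivrMr ?normr_gt0//; apply: le_trans (fle h) _.
    rewrite -real_normK ?num_real// expr2 mulrA ler_wpM2r//.
    rewrite -ler_pdivlMl// mulrC; near: h; apply: dnbhs0_le; exact: divr_gt0.
  rewrite f0; apply: DeriveDef; first by apply/cvg_ex; exists 0.
  by apply: cvg_lim.
Unshelve. all: by end_near. Qed.

Lemma Ck_flat_comp (V : normedModType R) n (U : set V) (q : V -> R) P : open U ->
  (forall k, Ck k U q) -> Ck n U (flat P \o q).
Proof.
move=> oU Cq.
have df t Q : differentiable (flat Q) t.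
  by apply/derivable1_diffP; have [] := is_derive_flat Q t.
have dq x (Ux : U x) : differentiable q x by exact: Ck_diff (Cq 0%N) Ux.
elim: n P => [|n IH] P;
  (split; first by move=> x Ux; apply: differentiable_comp; [exact: dq|exact: df]) => // v.
pose Q := 'X^2 * (P - P^`()).
apply: (@Ck_eq _ _ _ _ _ (fun x => 'D_v q x * (flat Q \o q) x) _ oU).
  move=> x Ux; rewrite (differentiable_comp_derive v (dq x Ux) (df (q x) P)) /=.
  have [_ D1] := is_derive_flat P (q x).
  have DE w : 'D_w (flat P) (q x) = w * 'D_1 (flat P) (q x).
    by rewrite !deriveE// -{1}(mulr1 w); exact: linearZ.
  by rewrite [RHS]DE D1.
by apply: CkM => //; exact: (Cq n.+1).2.
Qed.

(** The bump is [flat 1] of e^2 minus the squared Euclidean distance, normalised at [b]; the norm of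
    row vectors is the maximum norm, which is not smooth but is bounded by the Euclidean one. The
    bump is not constant near [b]: value 1 and zero derivative suffice for first-order computations
    there. *)
Lemma exists_bump m (b : 'rV[R]_m) (e : R) : 0 < e -> exists f : 'rV[R]_m -> R,
  [/\ forall n U, open U -> Ck n U f, f b = 1, forall v, 'D_v f b = 0 &
      forall y, f y != 0 -> `|y - b| < e].
Proof.
move=> e0; pose q (y : 'rV[R]_m) := \sum_i (y 0 i - b 0 i) ^+ 2.
have Cq k U : open U -> Ck k U q.
  move=> oU; apply: Ck_sum => // i; rewrite /=.
  have Cc : Ck k U (fun y : 'rV[R]_m => y 0 i - b 0 i).
    by apply: CkD => //; [exact: Ck_coord (Ck_id _ _)|exact: Ck_cst].
  by under eq_fun do rewrite expr2; exact: CkM.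
have qb : q b = 0 by rewrite /q big1// => i _; rewrite subrr expr0n.
have q0 y : 0 <= q y by apply: sumr_ge0 => i _; exact: sqr_ge0.
have dq y : differentiable q y by exact: (Ck_diff (Cq 0%N _ openT)).
have Dq v : 'D_v q b = 0.
  by apply: derive_min0 => //; near=> y.
pose g y := flat 1 (e ^+ 2 - q y).
have gb : 0 < g b by rewrite /g qb subr0 /flat exprn_gt0// hornerE mul1r expR_gt0.
have Cg n U : open U -> Ck n U g.
  move=> oU; apply: (@Ck_flat_comp _ n U (fun y => e ^+ 2 - q y) 1 oU) => k.
  apply: CkD => //; first exact: Ck_cst.
  under eq_fun do rewrite -mulN1r.
  by apply: CkM => //; [exact: Ck_cst|exact: Cq].
exists (fun y => (g b)^-1 * g y); split.
- by move=> n U oU; apply: CkM => //; [exact: Ck_cst|exact: Cg].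
- by rewrite mulVf// gt_eqF.
- move=> v; have dg : differentiable g b by exact: (Ck_diff (Cg 0%N _ openT)).
  rewrite deriveM//; last exact: diff_derivable.
  rewrite derive_cst scaler0 addr0.
  have dk : differentiable (fun y => e ^+ 2 - q y) b by exact: differentiableB.
  have df : differentiable (flat 1) (e ^+ 2 - q b).
    by apply/derivable1_diffP; have [] := is_derive_flat 1 (e ^+ 2 - q b).
  rewrite (differentiable_comp_derive v dk df) deriveB//; last exact: diff_derivable.
  by rewrite derive_cst Dq subrr derive0 scaler0.
- move=> y; rewrite mulf_eq0 negb_or => /andP[_].
  rewrite /g /flat; case: (ltP 0 (e ^+ 2 - q y)) => [qe _|_]; last by rewrite eqxx.
  rewrite subr_gt0 in qe.
  rewrite /Num.norm/= mx_normrE; apply/bigmax_ltP; split=> // -[i j] _ /=.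
  rewrite ord1 !mxE.
  have H : `|y 0 j - b 0 j| ^+ 2 < e ^+ 2.
    rewrite real_normK ?num_real//; apply: le_lt_trans qe.
    rewrite /q (bigD1 j)//= lerDl.
    by apply: sumr_ge0 => k _; exact: sqr_ge0.
  by move: H; rewrite ltr_pXn2r ?nnegrE ?(ltW e0).
Unshelve. all: by end_near. Qed.

End FlatFunction.

(** * Symmetry of second derivatives and level sets *)

Section Schwarz.
Variable R : realType.
Implicit Types V W : normedModType R.

Lemma nbhs_norm_lt V (b : V) (P : set V) : nbhs b P ->
  exists2 e : R, 0 < e & forall h, `|h| < e -> P (b + h).
Proof.
move=> /nbhs_ballP[e /= e0 H]; exists e => // h he; apply: H.
by rewrite -ball_normE /= opprD addrA subrr sub0r normrN.
Qed.

Lemma differentiable_eps V W (f : V -> W) b (e : R) : differentiable f b -> 0 < e ->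
  exists2 d : R, 0 < d & forall h, `|h| < d ->
    `|f (b + h) - f b - 'D_h f b| <= e * `|h|.
Proof.
move=> df e0; have [_ E] := (diff_locallyP _ _).1 df.
have [d d0 H] := nbhs_norm_lt ((eqaddoP _ _ _ _).1 E e e0).
exists d => // h /H; rewrite add0r.
by rewrite !fctE /= opprD addrA deriveE// [b + h]addrC.
Qed.

Lemma derive_bound V W (f : V -> W) b : differentiable f b ->
  exists2 L : R, 0 < L & forall v, `|'D_v f b| <= L * `|v|.
Proof.
move=> df; have [L L0 HL] := linear_lipschitz (diff_continuous df).
by exists L => // v; rewrite deriveE.
Qed.

Lemma segment_MVT V (f : V -> R) x w :
  (forall t, 0 <= t <= 1 -> differentiable f (x + t *: w)) ->
  exists2 t : R, 0 <= t <= 1 & f (x + w) - f x = 'D_w f (x + t *: w).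
Proof.
move=> df; pose k (t : R) := t *: w + x.
have dk t : differentiable k t := differentiable_line x w t.
have dfk t : 0 <= t <= 1 -> differentiable f (k t).
  by move=> t01; rewrite /k addrC; exact: df.
have H (t : R) : t \in `]0, 1[%R -> is_derive t 1 (f \o k) ('D_w f (k t)).
  move=> t01; have {}t01 : 0 <= t <= 1.
    by move: t01; rewrite in_itv/= => /andP[/ltW -> /ltW ->].
  apply: DeriveDef.
    by apply: diff_derivable; apply: differentiable_comp => //; exact: dfk.
  by rewrite (differentiable_comp_derive _ (dk t) (dfk t t01)) derive_line.
have cont : {within `[0, 1], continuous (f \o k)}.
  apply: derivable_within_continuous => t; rewrite in_itv/= => t01.
  by apply: diff_derivable; apply: differentiable_comp => //; exact: dfk.
have [t t01] := MVT ltr01 H cont.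
rewrite subr0 mulr1 /= /k scale1r scale0r add0r ![_ + x]addrC => E.
by exists t => //; move: t01; rewrite in_itv/= => /andP[/ltW -> /ltW ->].
Qed.

Let second_diff V (f : V -> R) b u v (t : R) : R :=
  f (b + t *: u + t *: v) - f (b + t *: u) - f (b + t *: v) + f b.

(** The mean value theorem for k(x) = f(x + t v) - f(x), from b to b + t u, turns the second
    difference into t times a difference of values of ['D_u f]. Both values are then compared with
    the linear approximation of ['D_u f] at [b]. *)
Lemma second_diff_eps V (f : V -> R) (U : set V) b u v (e : R) : open U -> U b ->
  Ck 1 U f -> 0 < e -> exists2 d : R, 0 < d & forall t, 0 < t -> t < d ->
  `|second_diff f b u v t - t ^+ 2 * 'D_v ('D_u f) b| <= e * t ^+ 2.
Proof.
move=> oU Ub Cf e0.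
have dg : differentiable ('D_u f) b by exact: (Cf.2 u).1.
(* Both displacements have norm at most t K, so each of the two remainders is at most e t / 2. The
   summand 1 keeps K positive and leaves a margin t for the strict inequalities. *)
pose K := `|u| + `|v| + 1.
have K0 : 0 < K by rewrite ltr_wpDl ?addr_ge0.
have eK : 0 < e / (2 * K) by rewrite divr_gt0 ?mulr_gt0.
have [d1 d10 Hd1] := nbhs_norm_lt (open_nbhs_nbhs (conj oU Ub)).
have [d2 d20 Hd2] := differentiable_eps dg eK.
exists (Num.min d1 d2 / K); first by rewrite divr_gt0// lt_min d10.
move=> t t0; rewrite ltr_pdivlMr// lt_min => /andP[tK1 tK2].
have small s : 0 <= s <= 1 -> `|s *: (t *: u)| <= t * `|u|.
  move=> /andP[s0 s1]; rewrite !normrZ !ger0_norm ?(ltW t0)//.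
  by rewrite ler_piMl// mulr_ge0// ltW.
have small2 s : 0 <= s <= 1 -> `|s *: (t *: u) + t *: v| <= t * K - t.
  move=> s01; apply: le_trans (ler_normD _ _) _.
  rewrite (le_trans (lerD (small s s01) (lexx _)))// normrZ gtr0_norm// /K; lra.
have inU h : `|h| <= t * K - t -> U (b + h) /\
    `|'D_u f (b + h) - 'D_u f b - 'D_h ('D_u f) b| <= e / (2 * K) * `|h|.
  by move=> hK; split; [apply: Hd1; lra|apply: Hd2; lra].
have small1 s : 0 <= s <= 1 -> `|s *: (t *: u)| <= t * K - t.
  move=> s01; apply: le_trans (small s s01) _.
  rewrite /K; have : 0 <= t * `|v| by rewrite mulr_ge0// ltW.
  by lra.
pose k x := f (x + t *: v) - f x.
have dk s : 0 <= s <= 1 -> is_derive (b + s *: (t *: u)) (t *: u) k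
   (t * ('D_u f (b + (s *: (t *: u) + t *: v)) - 'D_u f (b + s *: (t *: u))))
   /\ differentiable k (b + s *: (t *: u)).
  move=> s01.
  have U1 := (inU _ (small1 s s01)).1; have U2 := (inU _ (small2 s s01)).1.
  rewrite addrA in U2.
  have df1 : differentiable f (b + s *: (t *: u)) := Ck_diff Cf U1.
  have df2 : differentiable f (b + s *: (t *: u) + t *: v) := Ck_diff Cf U2.
  have ds : differentiable (fun x => x + t *: v) (b + s *: (t *: u)).
    by apply: differentiableD.
  have dfs : differentiable (f \o (fun x => x + t *: v)) (b + s *: (t *: u)).
    exact: differentiable_comp.
  split; last exact: differentiableB.
  apply: DeriveDef; first by apply: diff_derivable; exact: differentiableB.
  rewrite deriveB; [|exact: diff_derivable|exact: diff_derivable].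
  rewrite (differentiable_comp_derive _ ds df2).
  rewrite deriveD// derive_id derive_cst addr0.
  have DE y : differentiable f y -> 'D_(t *: u) f y = t * 'D_u f y.
    by move=> dfy; rewrite !deriveE//; exact: linearZ.
  by rewrite addrA (DE _ df1) (DE _ df2) -mulrBr.
have [s s01] := @segment_MVT _ k b (t *: u) (fun s s01 => (dk s s01).2).
have [_ ->] := (dk s s01).1 => E.
have -> : second_diff f b u v t = k (b + t *: u) - k b.
  by rewrite /second_diff /k; lra.
rewrite E.
have [_ H1] := inU _ (small1 s s01); have [_ H2] := inU _ (small2 s s01).
set h1 := s *: (t *: u) in H1 H2 *.
have Dh : 'D_(h1 + t *: v) ('D_u f) b = 'D_h1 ('D_u f) b + t * 'D_v ('D_u f) b.
  by rewrite [h1 + _]addrC (derive_linear _ _ _ dg) addrC.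
rewrite Dh in H2.
set a := 'D_u f (b + (h1 + t *: v)) in H2 *.
set c := 'D_u f (b + h1) in H1 *.
have regroup (p q d : R) : t * (a - c) - t ^+ 2 * d
  = t * ((a - p - (q + t * d)) - (c - p - q)) by ring.
rewrite (regroup ('D_u f b) ('D_h1 ('D_u f) b)).
rewrite normrM gtr0_norm// expr2 mulrCA ler_pM2l//.
apply: le_trans (ler_normB _ _) _.
apply: le_trans (lerD H2 H1) _.
have B1 : e / (2 * K) * `|h1| <= e / (2 * K) * (t * K).
  by rewrite ler_pM2l//; apply: le_trans (small1 s s01) _; rewrite gerBl ltW.
have B2 : e / (2 * K) * `|h1 + t *: v| <= e / (2 * K) * (t * K).
  by rewrite ler_pM2l//; apply: le_trans (small2 s s01) _; rewrite gerBl ltW.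
apply: le_trans (lerD B2 B1) _.
have -> : e / (2 * K) * (t * K) + e / (2 * K) * (t * K) = e * t.
  by field; rewrite gt_eqF.
by [].
Qed.

(** The second difference is symmetric in [u] and [v], and divided by t^2 it approximates both
    iterated derivatives. *)
Lemma derive_sym V (f : V -> R) (U : set V) b u v : open U -> U b ->
  Ck 1 U f -> 'D_v ('D_u f) b = 'D_u ('D_v f) b.
Proof.
move=> oU Ub Cf; apply/eqP; rewrite -subr_eq0 -normr_le0; apply/ler_addgt0Pl => e e0.
rewrite addr0.
have e2 : 0 < e / 2 by rewrite divr_gt0.
have [d1 d10 H1] := second_diff_eps u v oU Ub Cf e2.
have [d2 d20 H2] := second_diff_eps v u oU Ub Cf e2.
pose t := Num.min d1 d2 / 2.
have t0 : 0 < t by rewrite divr_gt0// lt_min d10.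
have tm : t < Num.min d1 d2 by rewrite /t ltr_pdivrMr// ltr_pMr ?ltr1n// lt_min d10.
move: (tm); rewrite lt_min => /andP[td1 td2].
have := H1 t t0 td1; have := H2 t t0 td2.
have -> : second_diff f b v u t = second_diff f b u v t.
  by rewrite /second_diff [b + t *: v + t *: u]addrAC; lra.
set D := second_diff _ _ _ _ _; set x := 'D_v _ _; set y := 'D_u _ _ => H3 H4.
have t2 : 0 < t ^+ 2 by rewrite exprn_gt0.
rewrite -(ler_pM2l t2) -{1}(gtr0_norm t2) -normrM.
have -> : t ^+ 2 * (x - y) = (D - t ^+ 2 * y) - (D - t ^+ 2 * x) by ring.
apply: le_trans (ler_normB _ _) _; apply: le_trans (lerD H3 H4) _.
by rewrite -mulrDl -splitr mulrC.
Qed.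

Lemma derive_sym_mx V p q (f : V -> 'M[R]_(p, q)) (U : set V) b u v :
  open U -> U b -> Ck 1 U f -> 'D_v ('D_u f) b = 'D_u ('D_v f) b.
Proof.
move=> oU Ub Cf; apply/matrixP => i j.
have dD w : differentiable ('D_w f) b := (Cf.2 w).1 b Ub.
have E w w' : 'D_w' ('D_w (fun y => f y i j)) b = 'D_w' ('D_w f) b i j.
  rewrite -(derive_coord _ _ _ (dD w)); apply: near_eq_derive.
  apply: filterS (open_nbhs_nbhs (conj oU Ub)) => y Uy.
  by rewrite derive_coord//; exact: Ck_diff Cf Uy.
apply: etrans (esym (E u v)) _; apply: etrans _ (E v u).
exact: derive_sym oU Ub (Ck_coord i j oU Cf).
Qed.

Lemma derive_close m (f : 'rV[R]_m -> R) (U : set 'rV[R]_m) b (e : R) :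
  open U -> U b -> Ck 1 U f -> 0 < e -> exists2 d : R, 0 < d &
  forall x, `|x - b| < d -> U x /\
    forall w, `|'D_w f x - 'D_w f b| <= e * `|w|.
Proof.
(* The m partial derivatives contribute at most m e' <= e; the successor avoids a division by 0 when
   m = 0. *)
move=> oU Ub Cf e0; pose e' := e / m.+1%:R.
have e'0 : 0 < e' by rewrite divr_gt0// ltr0n.
pose Q x := U x /\ forall i, `|'D_(delta_mx 0 i) f x - 'D_(delta_mx 0 i) f b| < e'.
have nQ : nbhs b Q.
  apply: filterI; first exact: open_nbhs_nbhs.
  near=> x => i; move: i; near: x; apply: filter_forall => i.
  have dD : differentiable ('D_(delta_mx 0 i) f) b by exact: (Cf.2 _).1.
  have /cvgrPdist_lt/(_ e' e'0) := differentiable_continuous dD.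
  by apply: filterS => x; rewrite distrC.
have [d d0 Hd] := nbhs_norm_lt nQ.
exists d => // x xd; have := Hd _ xd; rewrite addrC subrK => -[Ux Qx].
split=> // w.
have df : differentiable f x := Ck_diff Cf Ux.
have dfb : differentiable f b := Ck_diff Cf Ub.
rewrite (derive_row_sum _ df) (derive_row_sum _ dfb) -sumrB.
apply: le_trans (ler_norm_sum _ _ _) _.
have wi i : `|w 0 i| <= `|w|.
  by rewrite [leRHS]/Num.norm/= mx_normrE; apply: (le_bigmax _ _ (0, i)).
apply: (@le_trans _ _ (\sum_(i < m) e' * `|w|)).
  apply: ler_sum => i _; rewrite /GRing.scale/= -mulrBr normrM mulrC.
  by apply: ler_pM => //; exact: ltW.
rewrite sumr_const card_ord -[leLHS]mulr_natl mulrA ler_wpM2r//.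
rewrite /e' mulrCA ler_piMr ?(ltW e0)// ler_pdivrMr ?ltr0n// mul1r ler_nat.
exact: leqnSn.
Unshelve. all: by end_near. Qed.

(** The mean value theorem is applied to one coordinate at a time, which is enough because the norm
    is the maximum of the entries. The ball is convex, so it contains the segment from [y] to
    [x]. *)
Lemma strictly_differentiable m n (f : 'rV[R]_m -> 'rV[R]_n) (U : set 'rV[R]_m) b
    (e : R) :
  open U -> U b -> Ck 1 U f -> 0 < e -> exists2 d : R, 0 < d &
  forall x y, `|x - b| < d -> `|y - b| < d ->
    `|f x - f y - 'D_(x - y) f b| <= e * `|x - y|.
Proof.
move=> oU Ub Cf e0.
have dfb : differentiable f b := Ck_diff Cf Ub.
have Hj (j : 'I_n) : exists d : R, 0 < d /\ forall x, `|x - b| < d -> U x /\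
    forall w, `|'D_w (fun y => f y 0 j) x - 'D_w (fun y => f y 0 j) b| <= e * `|w|.
  by have [d d0 Hd] := derive_close oU Ub (Ck_coord 0 j oU Cf) e0; exists d.
pose dj j := sval (cid (Hj j)).
have djP j := svalP (cid (Hj j)).
have [dU dU0 HU] := nbhs_norm_lt (open_nbhs_nbhs (conj oU Ub)).
(* The start value [dU] is positive, which covers n = 0. *)
pose d := \big[Num.min/dU]_j dj j.
have d0 : 0 < d.
  by rewrite /d; elim/big_ind: _ => // [x y x0 y0|j _]; [rewrite lt_min x0|exact: (djP j).1].
exists d => // x y xd yd.
rewrite [leLHS]/Num.norm/= mx_normrE.
apply/bigmax_leP; split; first by rewrite mulr_ge0// ltW.
move=> -[i j] _ /=; rewrite ord1 {i}.
have ddj : d <= dj j by exact: bigmin_le_cond.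
have seg t : 0 <= t <= 1 -> `|y + t *: (x - y) - b| < dj j.
  move=> /andP[t0 t1].
  have -> : y + t *: (x - y) - b = (1 - t) *: (y - b) + t *: (x - b).
    by apply/rowP => k; rewrite !mxE; ring.
  apply: le_lt_trans (ler_normD _ _) _.
  rewrite !normrZ !ger0_norm ?subr_ge0//.
  have A : (1 - t) * `|y - b| <= (1 - t) * Num.max `|y - b| `|x - b|.
    by rewrite ler_wpM2l ?subr_ge0// le_max lexx.
  have B : t * `|x - b| <= t * Num.max `|y - b| `|x - b|.
    by rewrite ler_wpM2l// le_max lexx orbT.
  apply: (@le_lt_trans _ _ (Num.max `|y - b| `|x - b|)); first lra.
  by rewrite gt_max !(lt_le_trans _ ddj).
have [|t t01] := @segment_MVT _ (fun y => f y 0 j) y (x - y).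
  by move=> t t01; apply: (Ck_diff (Ck_coord 0 j oU Cf)); exact: ((djP j).2 _ (seg t t01)).1.
rewrite [y + (x - y)]addrC subrK => E.
rewrite !mxE E -(derive_coord _ _ _ dfb).
exact: ((djP j).2 _ (seg t t01)).2.
Qed.

(* The level set of f through b contains points b + t v + o(t): among the
   corrections w B with |w| <= C t, one minimising |f (b + t v + w B) - f b| is a
   zero, since otherwise subtracting the residual from w would decrease it. *)
Lemma derive_level_set m n p (f : 'rV[R]_m -> 'rV[R]_n) (h : 'rV[R]_m -> 'rV[R]_p)
    (U : set 'rV[R]_m) (B : 'M[R]_(n, m)) b v :
  open U -> U b -> Ck 1 U f -> (forall w, 'D_(w *m B) f b = w) ->
  differentiable h b -> (forall y, U y -> f y = f b -> h y = 0) ->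
  'D_v f b = 0 -> 'D_v h b = 0.
Proof.
move=> oU Ub Cf fB dh h0 Dv0.
have dfb : differentiable f b := Ck_diff Cf Ub.
have dB (w : 'rV[R]_n) : differentiable (fun w : 'rV[R]_n => w *m B) w.
  by apply: differentiable_mulmx => //; exact: differentiable_cst.
have [K K0 HK] : exists2 K : R, 0 < K & forall w : 'rV[R]_n, `|w *m B| <= K * `|w|.
  have [K K0 HK] := derive_bound (dB 0); exists K => // w.
  suff <- : 'D_w (fun w : 'rV[R]_n => w *m B) 0 = w *m B by exact: HK.
  by rewrite derive_mulmx// derive_id derive_cst mulmx0 addr0.
have [L L0 HL] := derive_bound dh.
apply/eqP; rewrite -normr_le0; apply/ler_addgt0Pl => e0 e00; rewrite addr0.
pose N := `|v| + 1; have N0 : 0 < N by rewrite ltr_wpDl.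
(* The final estimate is t |D_v h b| <= e t C, which explains the bound e0 / C on [e]. The bound 1 /
   (2 K) makes w |-> r w - w contracting with ratio 1/2, and e <= 1 keeps every correction below 5 t
   N. *)
pose C := N * (1 + 5 * K) + 4 * (L * K * N).
have K5 : 0 < 1 + 5 * K by lra.
have C0 : 0 < C by apply: addr_gt0; rewrite !mulr_gt0.
pose e := Num.min (Num.min 1 (2 * K)^-1) (e0 / C).
have eP : 0 < e by rewrite !lt_min ltr01 invr_gt0 mulr_gt0// divr_gt0.
have e1 : e <= 1 by rewrite !ge_min lexx.
have eK : e * K <= 2^-1.
  have : e <= (2 * K)^-1 by rewrite !ge_min lexx orbT.
  by rewrite invfM -ler_pdivlMr.
have eC : e * C <= e0 by rewrite -ler_pdivlMr// !ge_min lexx orbT.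
have [d1 d10 Hd1] := strictly_differentiable oU Ub Cf eP.
have [d2 d20 Hd2] := differentiable_eps dh eP.
have [d3 d30 Hd3] := nbhs_norm_lt (open_nbhs_nbhs (conj oU Ub)).
pose d := Num.min d1 (Num.min d2 d3).
have d0 : 0 < d by rewrite !lt_min d10 d20.
have M0 : 0 < 2 * (N * (1 + 5 * K)) by rewrite !mulr_gt0.
pose t := d / (2 * (N * (1 + 5 * K))).
have t0 : 0 < t by rewrite divr_gt0.
have td : t * (N * (1 + 5 * K)) < d.
  have : t * (2 * (N * (1 + 5 * K))) = d by rewrite /t divfK// gt_eqF.
  by lra.
have etN : 0 < e * t * N by do 2!apply: mulr_gt0 => //.
have etN1 : e * t * N <= t * N.
  by rewrite -mulrA ler_piMl// mulr_ge0// ltW.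
have B45 : 4 * (e * t * N) <= 5 * (t * N) by move: etN etN1; clear; lra.
(* The minimiser [c] will satisfy |c| <= 4 e t N and |r c| <= e t N, so this radius also admits the
   competitor c - r c. *)
pose rho := 5 * (e * t * N).
have rho0 : 0 < rho by rewrite mulr_gt0.
pose A : set 'rV[R]_n := closed_ball 0 rho.
have AE w : A w <-> `|w| <= rho.
  by rewrite /A closed_ballE// /closed_ball_/= sub0r normrN.
pose z (w : 'rV[R]_n) := t *: v + w *m B.
have zle w : A w -> `|z w| <= t * N + K * `|w|.
  move=> Aw; apply: le_trans (ler_normD _ _) _.
  rewrite lerD ?HK// normrZ gtr0_norm// ler_pM2l// /N; lra.
have zd w : A w -> `|z w| < d.
  move=> Aw; apply: le_lt_trans (zle w Aw) _; apply: le_lt_trans td.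
  have : K * `|w| <= K * (5 * (t * N)).
    rewrite ler_pM2l//; apply: le_trans ((AE w).1 Aw) _; rewrite /rho; lra.
  lra.
have [zd1 zd2 zd3] : [/\ forall w, A w -> `|z w| < d1, forall w, A w -> `|z w| < d2
    & forall w, A w -> `|z w| < d3].
  by split=> w /zd; rewrite !lt_min => /and3P[].
have zU w : A w -> U (b + z w) by move=> Aw; apply: Hd3; exact: zd3.
pose r w := f (b + z w) - f b.
have rw w w' : A w -> A w' -> `|r w - r w' - (w - w')| <= 2^-1 * `|w - w'|.
  move=> Aw Aw'.
  have zz : b + z w - (b + z w') = (w - w') *m B.
    by rewrite /z mulmxBl; apply/rowP => i; rewrite !mxE; ring.
  have := Hd1 (b + z w) (b + z w'); rewrite zz fB.
  have -> : r w - r w' = f (b + z w) - f (b + z w') by rewrite /r opprB addrA subrK.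
  rewrite ![b + _]addrC !addrK => /(_ (zd1 _ Aw) (zd1 _ Aw')) H.
  apply: le_trans H _; apply: (@le_trans _ _ (e * (K * `|w - w'|))).
    by rewrite ler_pM2l// HK.
  by rewrite mulrA ler_wpM2r.
have r0 w : A w -> `|r w - w| <= e * t * N + 2^-1 * `|w|.
  move=> Aw; have := Hd1 (b + z w) b.
  have -> : b + z w - b = z w by rewrite addrC addKr.
  rewrite subrr normr0.
  move=> /(_ (zd1 _ Aw) d10).
  have -> : 'D_(z w) f b = w.
    by rewrite /z derive_linear// Dv0 scaler0 add0r fB.
  move=> H; apply: le_trans H _.
  apply: le_trans (ler_wpM2l (ltW eP) (zle w Aw)) _.
  rewrite mulrDr mulrA lerD2l mulrA; exact: ler_wpM2r.
have A0 : A 0 by apply/AE; rewrite normr0 ltW.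
have Acomp : compact A.
  apply: bounded_closed_compact; last exact: closed_ball_closed.
  exists rho; split; first exact: num_real.
  by move=> x rx w /AE wr; apply: le_trans wr (ltW rx).
have cont : {within A, continuous (fun w => `|r w|)}.
  apply: continuous_in_subspaceT => w; rewrite inE => Aw.
  apply: continuous_comp; last exact: norm_continuous.
  apply: differentiable_continuous.
  apply: differentiableB; last exact: differentiable_cst.
  have dz : differentiable (fun w => b + z w) w.
    apply: differentiableD; first exact: differentiable_cst.
    by apply: differentiableD => //; exact: differentiable_cst.
  apply: (differentiable_comp dz); exact: Ck_diff Cf (zU w Aw).
have [c] := EVT_min_rV (ex_intro _ 0 A0) Acomp cont.
rewrite inE => Ac minc.
have rc : `|r c| <= e * t * N.
  apply: (@le_trans _ _ `|r 0|); first by apply: minc; rewrite inE.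
  by have := r0 0 A0; rewrite subr0 normr0 mulr0 addr0.
have c4 : `|c| <= 4 * (e * t * N).
  have H1 := r0 c Ac.
  have : `|c| <= `|r c| + `|r c - c|.
    by rewrite -{1}(subKr (r c) c); exact: ler_normB.
  lra.
have Ac' : A (c - r c).
  by apply/AE; apply: le_trans (ler_normB _ _) _; rewrite /rho; lra.
have rc0 : `|r c| = 0.
  have H1 : `|r c| <= `|r (c - r c)| by apply: minc; rewrite inE.
  have := rw _ _ Ac' Ac.
  have -> : c - r c - c = - r c by rewrite addrAC subrr add0r.
  rewrite opprK subrK normrN => H2.
  by apply/eqP; rewrite eq_le normr_ge0 andbT; lra.
have fc : f (b + z c) = f b.
  by apply/eqP; rewrite -subr_eq0 -normr_eq0; apply/eqP.
have := Hd2 (z c) (zd2 c Ac).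
rewrite (h0 _ (zU c Ac) fc) (h0 b Ub erefl) subrr sub0r normrN.
rewrite /z derive_linear// -/(z c) => H1.
have H2 : t * `|'D_v h b| <= e * `|z c| + `|'D_(c *m B) h b|.
  rewrite -{1}(gtr0_norm t0) -normrZ -{1}(addrK ('D_(c *m B) h b) (t *: _)).
  by apply: le_trans (ler_normB _ _) _; rewrite lerD2r.
have H3 : `|'D_(c *m B) h b| <= L * (K * (4 * (e * t * N))).
  apply: le_trans (HL _) _; rewrite ler_pM2l//; apply: le_trans (HK _) _.
  by rewrite ler_pM2l.
have H4 : e * `|z c| <= e * (t * N + K * (5 * (t * N))).
  rewrite ler_pM2l//; apply: le_trans (zle c Ac) _; rewrite lerD2l ler_pM2l//.
  exact: le_trans c4 B45.
apply: le_trans eC; rewrite -(ler_pM2l t0); apply: le_trans H2 _.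
apply: le_trans (lerD H4 H3) _.
by rewrite le_eqVlt; apply/orP; left; apply/eqP; rewrite /C; ring.
Qed.

End Schwarz.

(** * Tensor algebra at a point *)

Section PointwiseAlgebra.
Variable R : realFieldType.

(* Here B x u v = g((nabla_x phi) u, v) and E x u = g(nabla_x xi, u).  The
   Nijenhuis and cyclic identities make C u v w = B (phi u) v w, which is
   antisymmetric in v, w, satisfy C u v w = C v u w + C w u v. *)
Lemma cosymplectic_algebra (V : lmodType R) (phi : V -> V) (xi : V) (eta : V -> R)
    (B : V -> V -> V -> R) (E : V -> V -> R) :
  (forall u, phi (phi u) = - u + eta u *: xi) -> phi xi = 0 ->
  eta xi = 1 ->
  (forall a x y u v, B (a *: x + y) u v = a * B x u v + B y u v) ->
  (forall x a u u' v, B x (a *: u + u') v = a * B x u v + B x u' v) ->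
  (forall x u v, B x u v = - B x v u) ->
  (forall x u v, B x u v + B u v x + B v x u = 0) ->
  (forall u v w, B (phi u) v w - B (phi v) u w - B v u (phi w) + B u v (phi w) = 0) ->
  (forall x u v, B x (phi u) v - B x u (phi v) = E x u * eta v + eta u * E x v) ->
  (forall x, E x xi = 0) -> (forall x, E xi x = 0) ->
  (forall x u v, B x u v = 0) /\ (forall x u, E x u = 0).
Proof.
move=> phi2 phixi etaxi Bl1 Bl2 Bsk Bcyc Bnij BE Exi1 Exi2.
have star u v w : B (phi u) v w - B (phi v) u w - B (phi w) u v = 0.
  have := Bnij u v w; have := Bcyc (phi w) u v; have := Bsk v (phi w) u; lra.
(* Exchanging [u] and [w] in [star] changes, up to antisymmetry, only the sign of the middle term;
   subtracting leaves twice that term. *)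
have Bphi v u w : B (phi v) u w = 0.
  have := star u v w; have := star w v u.
  have := Bsk (phi w) v u; have := Bsk (phi v) w u; have := Bsk (phi u) w v; lra.
have B0 u v : B 0 u v = 0.
  by have := Bl1 1 0 0 u v; rewrite scale1r addr0; lra.
(* Every vector is a phi-image plus a multiple of xi, and [Bphi] kills phi-images in the first slot.
   So B reduces to B xi, then by the cyclic identity to u |-> B xi u xi, which also vanishes on
   phi-images and on xi. *)
have decomp (u : V) : u = (-1) *: phi (phi u) + eta u *: xi.
  by rewrite phi2 scalerDr !scaleN1r opprK -addrA addNr addr0.
have B1 x u v : B x u v = eta x * B xi u v.
  rewrite {1}(decomp x) Bl1 Bphi mulr0 add0r -{1}[_ *: xi]addr0 Bl1 B0.
  by rewrite addr0.
have Bxx u v : B xi u v = eta v * B xi u xi - eta u * B xi v xi.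
  have := Bcyc xi u v; rewrite (B1 u v xi) (B1 v xi u) (Bsk xi xi u); lra.
have Bb0 u : B xi (phi u) xi = 0.
  have := BE xi u xi; rewrite phixi Exi1 (Exi2 u).
  have -> : B xi u 0 = 0.
    have := Bl2 xi 1 0 0 u; rewrite scale1r addr0 (Bsk xi u); lra.
  lra.
have Bxixi : B xi xi xi = 0 by have := Bsk xi xi xi; lra.
have B00 x v : B x 0 v = 0.
  by have := Bl2 x 1 0 0 v; rewrite scale1r addr0; lra.
have Bb u : B xi u xi = 0.
  rewrite (decomp u) Bl2 Bb0 mulr0 add0r -[_ *: xi]addr0 Bl2 B00 Bxixi; lra.
have Bz x u v : B x u v = 0 by rewrite B1 Bxx !Bb; lra.
split=> // x u; have := BE x u xi; rewrite !Bz etaxi Exi1; lra.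
Qed.

(* Here J is the differential, II its second fundamental form and K the covariant
   derivative of the pullback metric.  On vertical u, v, w, the trilinear form
   K (phi v) u (phi w) is symmetric in u, w and antisymmetric in v, w. *)
Lemma submersion_algebra (V W : lmodType R) (vert hor : V -> Prop) (J : V -> W)
    (phi : V -> V) (xi : V) (G : W -> W -> R) (K : V -> V -> V -> R) (II : V -> V -> W) :
  (forall w w', G w w' = G w' w) ->
  (forall w, G 0 w = 0) -> (forall w w' y, G (w + w') y = G w y + G w' y) ->
  (forall w, (forall z, hor z -> G w (J z) = 0) -> w = 0) ->
  (forall u, vert u -> J u = 0) ->
  (forall x u u', II x (u + u') = II x u + II x u') ->
  (forall x u, II x u = II u x) ->
  (forall a x u v y, K (a *: x + v) u y = a * K x u y + K v u y) ->
  (forall x a u v y, K x y (u + a *: v) = K x y u + a * K x y v) ->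
  (forall x u v, K x u v = G (II x u) (J v) + G (J u) (II x v)) ->
  (forall x u v, K x (phi u) v = K x u (phi v)) ->
  (forall x u, K x u xi = 0) ->
  (forall x y z, hor y -> hor z -> K x y z = 0) ->
  (forall v, exists a b, [/\ v = a + b, vert a & hor b]) ->
  (forall z, hor z -> exists w a, z = phi w + a *: xi /\ vert w) ->
  (forall w, vert w -> hor (phi w)) -> hor xi ->
  forall x u, hor x -> II x u = 0.
Proof.
move=> Gs G0 Gadd Gnd vJ IIadd IIs Kl1 Kl3 KE Kphi Kxi Khor dec horE horphi horxi.
have Ks x u v : K x u v = K x v u by rewrite !KE (Gs (J u)) (Gs (J v)) addrC.
have GII x u z : vert u -> G (II x u) (J z) = K x u z.
  by move=> vu; rewrite KE (vJ u vu) G0 addr0.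
(* For horizontal [x] and [z] the vanishing of K u x z makes G (II u x) (J z) antisymmetric in [x],
   [z]; the symmetry of II moves [u] out of the differentiation slot. *)
have Kanti x u z : vert u -> hor x -> hor z -> K x u z = - K z u x.
  move=> vu hx hz; have := Khor u x z hx hz.
  by rewrite KE (Gs (J x)) (IIs u x) (IIs u z) !GII//; lra.
have alpha v w u : vert v -> vert w -> vert u -> K (phi v) u (phi w) = 0.
  move=> vv vw vu.
  have s a b c : K (phi a) b (phi c) = K (phi a) c (phi b) by rewrite -Kphi Ks.
  have := Kanti (phi v) u (phi w) vu (horphi _ vv) (horphi _ vw).
  have := Kanti (phi v) w (phi u) vw (horphi _ vv) (horphi _ vu).
  have := Kanti (phi u) v (phi w) vv (horphi _ vu) (horphi _ vw).
  have := s v u w; have := s u v w; have := s w u v; lra.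
have Khv x u z : hor x -> hor z -> vert u -> K x u z = 0.
  move=> hx hz vu.
  (* K kills xi, so both horizontal arguments may be replaced by phi-images of vertical vectors, the
     case of [alpha]. *)
  have [v [a [zE vv]]] := horE z hz.
  rewrite zE Kl3 Kxi mulr0 addr0 Kanti//; last exact: horphi.
  have [w [b [xE vw]]] := horE x hx.
  rewrite xE Kl3 Kxi mulr0 addr0 alpha//; lra.
have IIhv x u : hor x -> vert u -> II x u = 0.
  by move=> hx vu; apply: Gnd => z hz; rewrite GII// Khv.
have IIhh x y : hor x -> hor y -> II x y = 0.
  move=> hx hy; apply: Gnd => z hz.
  (* On horizontal vectors G (II a b) (J c) is symmetric in [a], [b] and antisymmetric in [b], [c],
     hence zero, as in the uniqueness of the Levi-Civita connection. *)
  have T a b c : hor b -> hor c -> G (II a b) (J c) = - G (II a c) (J b).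
    by move=> hb hc; have := Khor a b c hb hc; rewrite KE (Gs (J b)); lra.
  have := T x y z hy hz; have := T z x y hx hy; have := T y z x hz hx.
  rewrite (IIs z y) (IIs z x) (IIs y x); lra.
move=> x u hx; have [a [b [-> va hb]]] := dec u.
by rewrite IIadd IIhv// IIhh// addr0.
Qed.

End PointwiseAlgebra.

(** * Linear algebra of a Riemannian submersion at one point *)

Section SubmersionLinearAlgebra.
Variable R : realFieldType.

(** The same body as [ev2], for a single matrix instead of a field of matrices: the two are
    convertible, which lets the hypotheses on fields apply directly. *)
Definition bil m (A : 'M[R]_m) (u v : 'rV[R]_m) : R := (u *m A *m v^T) 0 0.

Lemma bilDl m (A : 'M[R]_m) u v w : bil A (u + v) w = bil A u w + bil A v w.
Proof. by rewrite /bil !mulmxDl mxE. Qed.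

Lemma bilDr m (A : 'M[R]_m) u v w : bil A w (u + v) = bil A w u + bil A w v.
Proof. by rewrite /bil linearD mulmxDr mxE. Qed.

Lemma bilZl m (A : 'M[R]_m) a u w : bil A (a *: u) w = a * bil A u w.
Proof. by rewrite /bil -!scalemxAl mxE. Qed.

Lemma bilZr m (A : 'M[R]_m) a u w : bil A w (a *: u) = a * bil A w u.
Proof. by rewrite /bil linearZ/= -scalemxAr mxE. Qed.

Lemma bilNl m (A : 'M[R]_m) u w : bil A (- u) w = - bil A u w.
Proof. by rewrite -scaleN1r bilZl mulN1r. Qed.

Lemma bilNr m (A : 'M[R]_m) u w : bil A w (- u) = - bil A w u.
Proof. by rewrite -scaleN1r bilZr mulN1r. Qed.

Lemma bil0l m (A : 'M[R]_m) w : bil A 0 w = 0.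
Proof. by rewrite /bil !mul0mx mxE. Qed.

Lemma bil0r m (A : 'M[R]_m) w : bil A w 0 = 0.
Proof. by rewrite /bil trmx0 mulmx0 mxE. Qed.

Lemma bilD m (A B : 'M[R]_m) u w : bil (A + B) u w = bil A u w + bil B u w.
Proof. by rewrite /bil mulmxDr mulmxDl mxE. Qed.

Lemma bil_pull m n (T : 'M[R]_(m, n)) (A : 'M[R]_n) u v :
  bil (T *m A *m T^T) u v = bil A (u *m T) (v *m T).
Proof. by rewrite /bil trmx_mul !mulmxA. Qed.

Lemma bil_mulr m (A B : 'M[R]_m) u v : bil (A *m B) u v = bil A u (v *m B^T).
Proof. by rewrite /bil trmx_mul trmxK !mulmxA. Qed.

Lemma bil_tr m (A : 'M[R]_m) u v : bil A^T u v = bil A v u.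
Proof. rewrite /bil.
have -> : u *m A^T *m v^T = (v *m A *m u^T)^T by rewrite !trmx_mul trmxK mulmxA.
by rewrite mxE. Qed.

Lemma bil_eq m (A B : 'M[R]_m) : (forall u v, bil A u v = bil B u v) -> A = B.
Proof.
move=> AB; apply/matrixP => i j; have := AB (delta_mx 0 i) (delta_mx 0 j).
by rewrite /bil trmx_delta -!rowE -!colE !mxE.
Qed.

Section Point.
Variables (m n : nat) (g : 'M[R]_m) (gN : 'M[R]_n) (T : 'M[R]_(m, n)).
Hypothesis gsym : forall u v, bil g u v = bil g v u.
Hypothesis gpos : forall v, v != 0 -> 0 < bil g v v.
Hypothesis gNsym : forall u v, bil gN u v = bil gN v u.
Hypothesis gNpos : forall v, v != 0 -> 0 < bil gN v v.
Let ver := kermx T.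
Let hor := kermx (g *m ver^T).
Hypothesis isom : forall u, (u <= hor)%MS -> bil gN (u *m T) (u *m T) = bil g u u.
Hypothesis rankT : \rank T = n.
Let h := T *m gN *m T^T.

Lemma posdef_unit p (A : 'M[R]_p) : (forall v, v != 0 -> 0 < bil A v v) -> A \in unitmx.
Proof.
move=> Apos; rewrite -row_free_unit -kermx_eq0; apply/eqP/row_matrixP => i.
rewrite row0; apply/eqP; apply: contraT => /Apos.
by rewrite /bil -row_mul mulmx_ker row0 mul0mx mxE ltxx.
Qed.

Lemma verE (u : 'rV[R]_m) : (u <= ver)%MS <-> u *m T = 0.
Proof. by split => [/sub_kermxP|H]//; apply/sub_kermxP. Qed.

Lemma hor_ver u v : (u <= hor)%MS -> (v <= ver)%MS -> bil g u v = 0.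
Proof.
move=> /sub_kermxP; rewrite mulmxA => gu /submxP[D ->].
by rewrite /bil trmx_mul mulmxA gu mul0mx mxE.
Qed.

Lemma ver_hor_decomp v : exists a b : 'rV[R]_m, [/\ v = a + b, (a <= ver)%MS & (b <= hor)%MS].
Proof.
have cap0 : (ver :&: hor = 0)%MS.
  apply/eqP; rewrite -submx0; apply/rV_subP => u.
  rewrite sub_capmx => /andP[uv uh]; rewrite submx0; apply: contraT => /gpos.
  by rewrite hor_ver// ltxx.
have full : row_full (ver + hor)%MS.
  have gu := posdef_unit gpos.
  have r1 : \rank (g *m ver^T) = \rank ver.
    rewrite -mxrank_tr trmx_mul trmxK mxrankMfree//.
    by rewrite row_free_unit unitmx_tr.
  rewrite /row_full mxrank_disjoint_sum// [\rank hor]mxrank_ker r1.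
  by rewrite subnKC// rank_leq_col.
have : (v <= ver + hor)%MS by apply: submx_full.
move=> /sub_addsmxP[[D E]] /= ->.
by exists (D *m ver), (E *m hor); rewrite !submxMl.
Qed.

Lemma bil_h u v : bil h u v = bil gN (u *m T) (v *m T).
Proof. exact: bil_pull. Qed.

Lemma bil_hsym u v : bil h u v = bil h v u.
Proof. by rewrite !bil_h gNsym. Qed.

Lemma bil_h_ver u v : (u <= ver)%MS -> bil h u v = 0.
Proof. by move=> /verE uT; rewrite bil_h uT bil0l. Qed.

(** The vertical part of [v] contributes 0 to both sides. For the horizontal part, [isom] only
    speaks of lengths and is polarised. *)
Lemma bil_h_hor u v : (u <= hor)%MS -> bil h u v = bil g u v.
Proof.
move=> uh; have [a [b [-> av bh]]] := ver_hor_decomp v.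
rewrite !bilDr bil_hsym bil_h_ver// hor_ver// !add0r.
have huu := isom uh; have hbb := isom bh.
have := isom (addmx_sub uh bh).
rewrite -!bil_h !bilDl !bilDr in huu hbb *.
rewrite (bil_hsym b u) (gsym b u) huu hbb; lra.
Qed.

(** The difference is the squared length of the vertical part. *)
Lemma bil_h_le v : bil h v v <= bil g v v.
Proof.
have [a [b [-> av bh]]] := ver_hor_decomp v.
have ga : 0 <= bil g a a.
  by have [->|/gpos/ltW//] := eqVneq a 0; rewrite bil0l.
rewrite !bilDl !bilDr !(bil_h_ver _ av) (bil_hsym b a) (bil_h_ver _ av).
rewrite (gsym a b) (hor_ver bh av) (bil_h_hor _ bh); lra.
Qed.

(** T is onto and kills vertical vectors, so [w] is the image of a horizontal vector, which then
    serves as the test vector. *)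
Lemma hor_nondeg w : (forall z, (z <= hor)%MS -> bil gN w (z *m T) = 0) -> w = 0.
Proof.
move=> H; have Tfull : row_full T by rewrite /row_full rankT.
have /submxP[v wE] : (w <= T)%MS by apply: submx_full.
have [a [b [vE av bh]]] := ver_hor_decomp v.
have wb : w = b *m T by rewrite wE vE mulmxDl ((verE a).1 av) add0r.
by apply/eqP; apply: contraT => /gNpos; rewrite {2}wb H// ltxx.
Qed.

(** The subtracted term is the horizontal part [b] of [u], since h(u, .) = h(b, .) = g(b, .). *)
Lemma vertical_projection (u : 'rV[R]_m) : (u - u *m h *m invmx g) *m T = 0.
Proof.
have gu := posdef_unit gpos.
have [a [b [uE av bh]]] := ver_hor_decomp u.
have ug : u *m h = b *m g.
  apply/rowP => j; have := bil_h_hor (delta_mx 0 j) bh.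
  have <- : bil h u (delta_mx 0 j) = bil h b (delta_mx 0 j).
    by rewrite uE bilDl (bil_h_ver _ av) add0r.
  by rewrite /bil trmx_delta -!colE !mxE.
by rewrite ug mulmxK// uE addrK ((verE a).1 av).
Qed.

Section Contact.
Variables (phi : 'M[R]_m) (xi : 'rV[R]_m) (eta : 'rV[R]_m -> R).
Hypothesis phi2 : forall u, u *m phi *m phi = - u + eta u *: xi.
Hypothesis phixi : xi *m phi = 0.
Hypothesis etaphi : forall u, eta (u *m phi) = 0.
Hypothesis gphi : forall u v, bil g (u *m phi) (v *m phi) = bil g u v - eta u * eta v.
Hypothesis gxi : forall u, eta u = bil g u xi.
Hypothesis split : (hor == ver *m phi + xi)%MS.

Lemma hor_xi : (xi <= hor)%MS.
Proof. by rewrite (eqmxP split) addsmxSr. Qed.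

Lemma hor_phi (w : 'rV[R]_m) : (w <= ver)%MS -> (w *m phi <= hor)%MS.
Proof.
move=> wv; rewrite (eqmxP split); apply: submx_trans (addsmxSl _ _).
exact: submxMr.
Qed.

Lemma hor_split z : (z <= hor)%MS ->
  exists (w : 'rV[R]_m) a, z = w *m phi + a *: xi /\ (w <= ver)%MS.
Proof.
rewrite (eqmxP split) => /sub_addsmxP[[D E]] /= ->.
exists (D *m ver), (E 0 0); rewrite submxMl mulmxA {1}[E]mx11_scalar mul_scalar_mx.
by [].
Qed.

Lemma bil_h_xi u : bil h u xi = eta u.
Proof. by rewrite bil_hsym (bil_h_hor _ hor_xi) gsym gxi. Qed.

(* Equivalently, phi P + P phi = phi for the horizontal projection P. *)
Lemma bil_h_phi u v : bil h (u *m phi) v - bil h u (v *m phi) = bil g (u *m phi) v.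
Proof.
have eta_ver w : (w <= ver)%MS -> eta w = 0.
  by move=> wv; rewrite gxi gsym (hor_ver hor_xi wv).
have [a [b [-> av bh]]] := ver_hor_decomp u.
rewrite !mulmxDl !bilDl (bil_h_hor _ (hor_phi av)) (bil_h_ver _ av).
(* On the horizontal part phi w + c xi, phi returns the vertical vector -w, so the first term
   vanishes and the second is g(phi w, phi v) = g(w, v). *)
have [w [c [-> wv]]] := hor_split bh.
rewrite !mulmxDl -!scalemxAl phixi scaler0 addr0 phi2 (eta_ver w wv) scale0r addr0.
have -> : bil h (w *m phi + c *: xi) (v *m phi) = bil g w v.
  rewrite bilDl bilZl (bil_h_hor _ (hor_phi wv)) (bil_h_hor _ hor_xi).
  by rewrite gphi (eta_ver w wv) mul0r subr0 (gsym xi) -gxi etaphi mulr0 addr0.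
rewrite !bilNl (bil_h_ver _ wv); lra.
Qed.

End Contact.
End Point.
End SubmersionLinearAlgebra.

(* G1, F1, X1 and e1 stand for the directional derivatives of the coordinate
   matrices of g, phi, xi and eta, and Gam for the Christoffel symbols. *)
Lemma cosymplectic_parallel_algebra (R : realFieldType) (V : lmodType R)
    (G : V -> V -> R) (G1 : V -> V -> V -> R) (phi : V -> V) (F1 : V -> V -> V)
    (xi : V) (X1 : V -> V) (eta : V -> R) (e1 : V -> V -> R) (Gam : V -> V -> V) :
  (forall u v, G u v = G v u) ->
  (forall a u v w, G (a *: u + v) w = a * G u w + G v w) ->
  (forall a, (forall w, G a w = 0) -> a = 0) ->
  (forall a u v, phi (a *: u + v) = a *: phi u + phi v) ->
  (forall u, phi (phi u) = - u + eta u *: xi) -> phi xi = 0 ->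
  eta xi = 1 -> (forall u, eta u = G u xi) ->
  (forall u v, G (phi u) v = - G u (phi v)) ->
  (forall u v, Gam u v = Gam v u) ->
  (forall x a u v, Gam x (a *: u + v) = a *: Gam x u + Gam x v) ->
  (forall a x y u, F1 (a *: x + y) u = a *: F1 x u + F1 y u) ->
  (forall x a u v, F1 x (a *: u + v) = a *: F1 x u + F1 x v) ->
  (forall x u v, G1 x u v = G (Gam x u) v + G u (Gam x v)) ->
  (forall x u v, G1 x u (phi v) + G u (F1 x v) + G1 x (phi u) v + G (F1 x u) v = 0) ->
  (forall x u, phi (F1 x u) + F1 x (phi u) = e1 x u *: xi + eta u *: X1 x) ->
  (forall x u, e1 x u = G1 x u xi + G u (X1 x)) ->
  (forall x, G1 x xi xi + 2 * G (X1 x) xi = 0) ->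
  (forall x u v, (G1 x u (phi v) + G u (F1 x v)) + (G1 u v (phi x) + G v (F1 u x))
    + (G1 v x (phi u) + G x (F1 v u)) = 0) ->
  (forall u v, F1 (phi u) v - F1 (phi v) u + phi (F1 v u) - phi (F1 u v) = 0) ->
  (forall u v, e1 u v = e1 v u) ->
  (forall x u, F1 x u + Gam x (phi u) - phi (Gam x u) = 0) /\
  (forall x, X1 x + Gam x xi = 0).
Proof.
move=> Gs Gl Gnd phil phi2 phixi etaxi etaG skew Gams Gaml F1l F1r met d5 d2 d4 d6
  cyc nij deta.
have G0 w : G 0 w = 0 by have := Gl 1 0 0 w; rewrite scale1r addr0; lra.
have GD u v w : G (u + v) w = G u w + G v w.
  by have := Gl 1 u v w; rewrite scale1r mul1r.
have GZ a u w : G (a *: u) w = a * G u w.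
  by have := Gl a u 0 w; rewrite !addr0 G0 addr0.
have GN u w : G (- u) w = - G u w by rewrite -scaleN1r GZ mulN1r.
have phi0 : phi 0 = 0.
  have := phil 1 0 0; rewrite !scale1r addr0 => /eqP.
  by rewrite eq_sym -subr_eq0 addrK => /eqP.
have phiD u v : phi (u + v) = phi u + phi v.
  by have := phil 1 u v; rewrite !scale1r.
have phiN u : phi (- u) = - phi u.
  by have := phil (-1) u 0; rewrite !scaleN1r phi0 !addr0.
have Gam0 x : Gam x 0 = 0.
  have := Gaml x 1 0 0; rewrite !scale1r addr0 => /eqP.
  by rewrite eq_sym -subr_eq0 addrK => /eqP.
(* [N] is the covariant derivative of phi. In each hypothesis of [cosymplectic_algebra] the
   Christoffel terms cancel by their symmetry and by metric compatibility. *)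
pose N x u := F1 x u + Gam x (phi u) - phi (Gam x u).
pose B x u v := G (N x u) v.
pose E x u := G (X1 x + Gam x xi) u.
have BE x u v : B x u v = G (F1 x u) v + G (Gam x (phi u)) v + G (Gam x u) (phi v).
  by rewrite /B /N !GD GN skew opprK.
have EE x u : E x u = G (X1 x) u + G (Gam x xi) u by rewrite /E GD.
have e1E x u : e1 x u = E x u + G (Gam x u) xi.
  rewrite d4 met EE (Gs u (X1 x)) (Gs u (Gam x xi)); lra.
have [Bz Ez] : (forall x u v, B x u v = 0) /\ (forall x u, E x u = 0).
  apply: (cosymplectic_algebra phi2 phixi etaxi).
  - move=> a x y u v; rewrite !BE F1l !(Gams _ (phi u)) !(Gams _ u) !Gaml !GD !GZ; lra.
  - move=> x a u u' v; rewrite !BE F1r phil !Gaml !GD !GZ; lra.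
  - move=> x u v; have := d5 x u v; rewrite !met !BE.
    rewrite (Gs u (F1 x v)) (Gs u (Gam x (phi v))) (Gs (phi u) (Gam x v)); lra.
  - move=> x u v.
    have Bsk a b c : B a b c = - B a c b.
      have := d5 a b c; rewrite !met !BE.
      rewrite (Gs b (F1 a c)) (Gs b (Gam a (phi c))) (Gs (phi b) (Gam a c)); lra.
    have S a b c : G1 a b (phi c) + G b (F1 a c)
        = B a c b - G (Gam a c) (phi b) + G (Gam a b) (phi c).
      rewrite met BE (Gs b (F1 a c)) (Gs b (Gam a (phi c))); lra.
    have := cyc x u v; rewrite !S (Gams u x) (Gams v x) (Gams v u).
    have := Bsk x v u; have := Bsk u x v; have := Bsk v u x; lra.
  - move=> u v w; have := congr1 (G^~ w) (nij u v).
    rewrite /= !GD !GN G0 !skew !BE.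
    rewrite !(Gams (phi u)) !(Gams (phi v)) (Gams v u).
    have phi3 a : G a (phi (phi w)) = - G a w + eta w * eta a.
      by rewrite Gs phi2 GD GN GZ (Gs w) (Gs xi) -etaG.
    rewrite !phi3; lra.
  - move=> x u v; have := congr1 (G^~ v) (d2 x u).
    rewrite /= !GD !GZ skew !BE e1E phi2.
    have Gx : Gam x (- u + eta u *: xi) = - Gam x u + eta u *: Gam x xi.
      rewrite addrC Gaml addrC; congr (_ + _).
      by have := Gaml x (-1) u 0; rewrite !scaleN1r !addr0 Gam0 addr0.
    rewrite Gx !GD GN GZ.
    have phi3 a : G a (phi (phi v)) = - G a v + eta v * eta a.
      by rewrite Gs phi2 GD GN GZ (Gs v) (Gs xi) -etaG.
    rewrite phi3 !(EE x v) (Gs xi v) -!etaG; lra.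
  - move=> x; have := d6 x; rewrite met EE (Gs xi (Gam x xi)); lra.
  (* Closedness of eta makes E symmetric, and E x xi = 0 because xi has unit length; so xi is
     geodesic. *)
  - move=> x; have := deta xi x; rewrite !e1E (Gams x xi).
    have := d6 x; rewrite met !EE (Gs xi (Gam x xi)); lra.
split=> [x u|x]; apply: Gnd => w; first exact: Bz.
exact: Ez.
Qed.

Lemma near_open (R : realType) (V : normedModType R) (U : set V) x (P : V -> Prop) :
  open U -> U x -> (forall y, U y -> P y) -> \forall y \near x, P y.
Proof. by move=> oU Ux UP; exact: filterS (open_nbhs_nbhs (conj oU Ux)). Qed.

(** * Coordinate representations *)

Section Charts.
Local Opaque diff derive jacobian.
Variables (R : realType) (m : nat) (M : manifold R m).
Implicit Types (c d e : chart R m M) (p q : M).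

Lemma continuous_of_coord_at c y : target c y -> {for y, continuous (of_coord c)}.
Proof.
move=> cy; have := @continuous_of_coord _ _ _ c.
rewrite continuous_open_subspace; last exact: open_target.
by apply; rewrite inE.
Qed.

Lemma open_target_preimage c (A : set M) : open A ->
  open (target c `&` of_coord c @^-1` A).
Proof.
move=> oA; rewrite openE => y [cy Ay]; apply: filterI.
  by apply: open_nbhs_nbhs; split => //; exact: open_target.
by apply: (continuous_of_coord_at cy); exact: open_nbhs_nbhs.
Qed.

Definition overlap c d := target c `&` of_coord c @^-1` source d.

Lemma open_overlap c d : open (overlap c d).
Proof. exact: open_target_preimage (open_source d). Qed.

Lemma transition_overlap c d y : overlap c d y -> overlap d c (transition c d y).
Proof.
move=> [cy dy]; split; first exact: to_coord_target.
by rewrite /= /transition to_coordK//; exact: of_coord_source.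
Qed.

Lemma of_transition c d y : overlap c d y -> of_coord d (transition c d y) = of_coord c y.
Proof. by move=> [_ dy]; rewrite /transition to_coordK. Qed.

Lemma Ck_transition c d k : atlas c -> atlas d -> Ck k (overlap c d) (transition c d).
Proof.
by move=> ca da; apply: (smooth_onE (overlap c d) (transition c d)).1;
  exact: atlas_compatible.
Qed.

Lemma differentiable_transition c d y : atlas c -> atlas d -> overlap c d y ->
  differentiable (transition c d) y.
Proof. by move=> ca da cdy; exact: Ck_diff (Ck_transition 0 ca da) cdy. Qed.

Lemma jacobian_transition c d e y : atlas c -> atlas d -> atlas e ->
  overlap c d y -> source e (of_coord c y) ->
  jacobian (transition c e) y
  = jacobian (transition c d) y *m jacobian (transition d e) (transition c d y).
Proof.
move=> ca da ea cdy ey.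
have dey : overlap d e (transition c d y).
  by split; [exact: to_coord_target cdy.2|rewrite /= of_transition].
have d1 := differentiable_transition ca da cdy.
have d2 := differentiable_transition da ea dey.
rewrite -(jacobian_comp d1 d2); apply: jacobian_near.
  apply: (near_open (@open_overlap c d) cdy) => z cdz.
  by rewrite /= {1}/transition -(of_transition cdz).
by apply: differentiable_transition => //; split => //; exact: cdy.1.
Qed.

Lemma jacobian_transition_id c y : atlas c -> target c y ->
  jacobian (transition c c) y = 1%:M.
Proof.
move=> ca cy; rewrite -(jacobian_id y); apply: jacobian_near.
  apply: (near_open (@open_target _ _ _ c) cy) => z cz.
  by rewrite /transition of_coordK.
by apply: differentiable_transition => //; split => //; exact: of_coord_source.
Qed.

Lemma base_target p : target (chart_at p) (base p).
Proof. exact: to_coord_target (chart_at_source p). Qed.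

Lemma of_base p : of_coord (chart_at p) (base p) = p.
Proof. by rewrite to_coordK//; exact: chart_at_source. Qed.

Lemma overlap_to c d p : source c p -> source d p -> overlap c d (to_coord c p).
Proof.
by move=> cp dp; split; [exact: to_coord_target|rewrite /= to_coordK].
Qed.

Lemma transition_to c d p : source c p -> transition c d (to_coord c p) = to_coord d p.
Proof. by move=> cp; rewrite /transition to_coordK. Qed.

Lemma tan_to_transition c d p : atlas c -> atlas d -> source c p -> source d p ->
  tan_to d p = tan_to c p *m jacobian (transition c d) (to_coord c p).
Proof.
move=> ca da cp dp; rewrite /tan_to.
rewrite (jacobian_transition (chart_at_atlas p) ca da); last 2 first.
- exact: overlap_to (chart_at_source p) cp.
- by rewrite of_base.
by rewrite /base transition_to//; exact: chart_at_source.
Qed.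

Lemma tan_toK c p : atlas c -> source c p -> tan_to c p *m tan_from c p = 1%:M.
Proof.
move=> ca cp.
have cpp := chart_at_source p.
rewrite /tan_to /tan_from -(transition_to c cpp) -jacobian_transition//.
- by apply: jacobian_transition_id; [exact: chart_at_atlas|exact: base_target].
- exact: chart_at_atlas.
- exact: chart_at_atlas.
- exact: overlap_to.
- by rewrite of_base.
Qed.

Lemma tan_fromK c p : atlas c -> source c p -> tan_from c p *m tan_to c p = 1%:M.
Proof. by move=> ca cp; apply: mulmx1C; exact: tan_toK. Qed.

Lemma tan_from_to c d p : atlas c -> atlas d -> source c p -> source d p ->
  tan_from c p *m tan_to d p = jacobian (transition c d) (to_coord c p).
Proof.
move=> ca da cp dp.
by rewrite (tan_to_transition ca da cp dp) mulmxA tan_fromK// mul1mx.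
Qed.

Lemma tan_to_base p : tan_to (chart_at p) p = 1%:M.
Proof.
by apply: jacobian_transition_id; [exact: chart_at_atlas|exact: base_target].
Qed.

Lemma tan_from_base p : tan_from (chart_at p) p = 1%:M.
Proof. exact: tan_to_base. Qed.

Lemma vec_rep_base (X : vector_field M) p : vec_rep (chart_at p) X (base p) = X p.
Proof. by rewrite /vec_rep /= of_base tan_to_base mulmx1. Qed.

Lemma form_rep_base (w : one_form M) p : form_rep (chart_at p) w (base p) = w p.
Proof. by rewrite /form_rep /= of_base tan_from_base mul1mx. Qed.

Lemma endo_rep_base (A : endo_field M) p : endo_rep (chart_at p) A (base p) = A p.
Proof. by rewrite /endo_rep /= of_base tan_to_base tan_from_base mulmx1 mul1mx. Qed.

Lemma bilin_rep_base (b : bilin_field M) p : bilin_rep (chart_at p) b (base p) = b p.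
Proof. by rewrite /bilin_rep /= of_base tan_from_base trmx1 mulmx1 mul1mx. Qed.

Lemma bil_bilin_rep c (b : bilin_field M) y u v :
  bil (bilin_rep c b y) u v =
  bil (b (of_coord c y)) (u *m tan_from c (of_coord c y)) (v *m tan_from c (of_coord c y)).
Proof. exact: bil_pull. Qed.

Lemma vec_rep_from c (X : vector_field M) y : atlas c -> target c y ->
  vec_rep c X y *m tan_from c (of_coord c y) = X (of_coord c y).
Proof.
move=> ca cy; rewrite /vec_rep /=; have := tan_toK ca (of_coord_source cy).
by move: (tan_to _ _) (tan_from _ _) => T S TS; rewrite -mulmxA TS mulmx1.
Qed.

Lemma endo_rep_from c (A : endo_field M) y : atlas c -> target c y ->
  endo_rep c A y *m tan_from c (of_coord c y) = tan_from c (of_coord c y) *m A (of_coord c y).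
Proof.
move=> ca cy; rewrite /endo_rep /=; have := tan_toK ca (of_coord_source cy).
by move: (tan_to _ _) (tan_from _ _) => T S TS; rewrite -mulmxA TS mulmx1.
Qed.

Lemma vec_rep_endo c (A : endo_field M) (X : vector_field M) y : atlas c -> target c y ->
  vec_rep c (endo_app A X) y = vec_rep c X y *m endo_rep c A y.
Proof.
move=> ca cy; rewrite /vec_rep /endo_rep /endo_app /=.
have := tan_toK ca (of_coord_source cy).
move: (tan_to _ _) (tan_from _ _) => T S TS.
by rewrite !mulmxA -(mulmxA _ T S) TS mulmx1.
Qed.

(** The field [w] is multiplied by a bump and extended by 0. The factor [f] stays visible because
    the representative is w only up to this scalar. The last clause lets properties valid on the
    zero vector, such as verticality, extend to all of M. *)
Lemma exists_extension c (U : set 'rV[R]_m) b (w : 'rV[R]_m -> 'rV[R]_m) :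
  atlas c -> open U -> U `<=` target c -> U b -> (forall k, Ck k U w) ->
  exists (X : vector_field M) (f : 'rV[R]_m -> R),
  [/\ smooth_vector_field X, f b = 1, differentiable f b /\ (forall v, 'D_v f b = 0),
      forall y, U y -> vec_rep c X y = f y *: w y &
      forall q, ~ (source c q /\ U (to_coord c q)) -> X q = 0].
Proof.
move=> ca oU Uc Ub Cw.
have [r r0 rU] := nbhs_norm_lt (open_nbhs_nbhs (conj oU Ub)).
have r20 : 0 < r / 2 by rewrite divr_gt0.
have [f [Cf fb Df fr]] := exists_bump b r20.
pose K : set 'rV[R]_m := closed_ball b (r / 2).
have KE y : K y <-> `|y - b| <= r / 2.
  by rewrite /K closed_ballE// /closed_ball_/= distrC.
have KU : K `<=` U.
  move=> y /KE yb; rewrite -(subrKC b y); apply: rU; apply: le_lt_trans yb _.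
  by rewrite ltr_pdivrMr// ltr_pMr// ltr1n.
have Kc : compact K.
  apply: bounded_closed_compact; last exact: closed_ball_closed.
  exists (`|b| + r / 2); split; first exact: num_real.
  move=> x bx y /KE yb; apply: le_trans (ltW bx).
  by rewrite -{1}(subrKC b y); apply: le_trans (ler_normD _ _) _; rewrite lerD2l.
(* The Hausdorff axiom enters here: the compact support is closed in M, so its complement is open
   and the extension by 0 is smooth there. *)
have closedK : closed (of_coord c @` K).
  apply: compact_closed; first exact: manifold_hausdorff.
  apply: continuous_compact => //; apply: continuous_subspaceW (@continuous_of_coord _ _ _ c).
  by move=> y /KU /Uc.
pose good q := source c q /\ U (to_coord c q).
pose X : vector_field M := fun q =>
  if `[< good q >] then (f (to_coord c q) *: w (to_coord c q)) *m tan_from c q else 0.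
have Xgood q : good q -> X q = (f (to_coord c q) *: w (to_coord c q)) *m tan_from c q.
  by move=> gq; rewrite /X ifT//; apply/asboolP.
have Xbad q : ~ good q -> X q = 0.
  by move=> gq; rewrite /X ifF//; apply/asboolP.
exists X, f; split=> //; last 2 first.
- by split=> //; exact: (Ck_diff (Cf 0%N _ openT)).
- move=> y Uy; have cy := Uc y Uy; have sy := of_coord_source cy.
  have yy := of_coordK cy.
  rewrite /vec_rep /= Xgood; last by split; rewrite ?yy.
  by rewrite yy -mulmxA tan_fromK// mulmx1.
move=> d da; apply/smooth_onE => k; apply: Ck_local => y dy.
have [[cq Uq]|bad] := pselect (good (of_coord d y)).
  pose O := overlap d c `&` transition d c @^-1` U.
  have oO : open O.
    rewrite openE => z [dcz Uz]; apply: filterI.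
      by apply: open_nbhs_nbhs; split => //; exact: open_overlap.
    have cz := differentiable_continuous (differentiable_transition da ca dcz).
    by apply: cz; exact: open_nbhs_nbhs.
  exists O; first by split.
  have CT : Ck k O (transition d c).
    by apply: Ck_sub (Ck_transition k da ca) => z [].
  have CT' : Ck k (overlap c d) (jacobian (transition c d)).
    by apply: Ck_jacobian; [exact: open_overlap|exact: Ck_transition].
  have CJ : Ck k O (jacobian (transition c d) \o transition d c).
    apply: (Ck_comp_mx oO (@open_overlap c d) _ CT CT') => z [dcz _].
    exact: transition_overlap.
  have Cg : Ck k U (fun z => f z *: w z).
    by apply: Ck_scalemx => //; exact: Cf.
  have CG : Ck k O ((fun z => f z *: w z) \o transition d c).
    by apply: (Ck_comp_mx oO oU _ CT Cg) => z [].
  apply: Ck_eq oO _ (Ck_mulmx oO CG CJ) => z [dcz Uz].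
  have [dz cz] := dcz.
  rewrite /vec_rep /= Xgood; last by split.
  rewrite -mulmxA tan_from_to//; exact: of_coord_source.
(* Off the support the field vanishes for one of two reasons: the point lies outside the domain of
   [w], or the bump is 0 there. *)
pose O := target d `&` of_coord d @^-1` (~` (of_coord c @` K)).
have oO : open O by apply: open_target_preimage; exact: closed_openC.
have badK q : source c q -> U (to_coord c q) -> f (to_coord c q) != 0 ->
    (of_coord c @` K) q.
  move=> cq Uq /fr fq; exists (to_coord c q); last exact: to_coordK.
  by apply/KE; exact: ltW.
exists O.
  split=> // -[z Kz zq]; apply: bad; rewrite -zq.
  have cz : target c z by apply: Uc; exact: KU.
  by split; [exact: of_coord_source|rewrite of_coordK//; exact: KU].
apply: (Ck_eq oO _ (Ck_cst _ _ 0)) => z [dz zK].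
rewrite /vec_rep /=.
suff -> : X (of_coord d z) = 0 by rewrite mul0mx.
have [gz|/Xbad//] := pselect (good (of_coord d z)).
rewrite (Xgood _ gz); case: gz => cz Uz.
have [->|/badK fz] := eqVneq (f (to_coord c (of_coord d z))) 0.
  by rewrite scale0r mul0mx.
by case: zK; exact: fz.
Qed.

End Charts.

Section BilinearCalculus.
Local Opaque diff derive.
Variable R : realType.

Lemma differentiable_bil (V : normedModType R) m (A : V -> 'M[R]_m) (u v : V -> 'rV[R]_m) x :
  differentiable A x -> differentiable u x -> differentiable v x ->
  differentiable (fun y => bil (A y) (u y) (v y)) x.
Proof.
move=> dA du dv; apply: differentiable_coordE; apply: differentiable_mulmx.
  exact: differentiable_mulmx.
exact: differentiable_trmx.
Qed.

Lemma derive_bil (V : normedModType R) m (A : V -> 'M[R]_m) (u v : V -> 'rV[R]_m) x w :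
  differentiable A x -> differentiable u x -> differentiable v x ->
  'D_w (fun y => bil (A y) (u y) (v y)) x = bil ('D_w A x) (u x) (v x)
   + bil (A x) ('D_w u x) (v x) + bil (A x) (u x) ('D_w v x).
Proof.
move=> dA du dv.
have d1 := differentiable_mulmx du dA.
have d2 := differentiable_trmx dv.
have d3 := differentiable_mulmx d1 d2.
rewrite /bil (derive_coord _ _ _ d3) (derive_mulmx _ d1 d2) (derive_mulmx _ du dA).
by rewrite (derive_trmx _ dv) mulmxDl !mxE; ring.
Qed.

Lemma linear_rV_sum m (f : 'rV[R]_m -> R) :
  (forall a u v, f (a *: u + v) = a * f u + f v) ->
  forall u, f u = \sum_i u 0 i * f (delta_mx 0 i).
Proof.
move=> flin u; rewrite {1}(row_sum_delta u).
have f0 : f 0 = 0 by have := flin 1 0 0; rewrite scale1r addr0; lra.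
elim: (index_enum _) => [|i r IH]; first by rewrite !big_nil f0.
by rewrite !big_cons flin IH.
Qed.

Lemma posdef_inj m (g : 'M[R]_m) (a a' : 'rV[R]_m) :
  (forall v, v != 0 -> 0 < bil g v v) -> (forall w, bil g a w = bil g a' w) -> a = a'.
Proof.
move=> gpos H; apply/eqP; rewrite -subr_eq0; apply: contraT => /gpos.
by rewrite bilDl bilNl H subrr ltxx.
Qed.

End BilinearCalculus.

(** * Christoffel symbols: the Koszul formula and compatibility with the metric *)

Section Christoffel.
Local Opaque diff derive.
Variables (R : realType) (m : nat) (M : manifold R m) (g : bilin_field M).
Hypothesis hg : riemannian_metric g.
Variable p : M.

Lemma riem_sym q u v : bil (g q) u v = bil (g q) v u.
Proof. exact: (hg.2 q).1. Qed.

Lemma riem_pos q v : v != 0 -> 0 < bil (g q) v v.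
Proof. exact: (hg.2 q).2. Qed.

Lemma riem_inj q (a a' : 'rV[R]_m) : (forall w, bil (g q) a w = bil (g q) a' w) -> a = a'.
Proof. by apply: posdef_inj => v; exact: riem_pos. Qed.

Let gl := bilin_rep (chart_at p) g.
Let b := base p.
(* A variable, so that conversion never unfolds the derivative. *)
Variable g1 : 'rV[R]_m -> 'M[R]_m.
Hypothesis g1E : forall x, 'D_x (bilin_rep (chart_at p) g) (base p) = g1 x.

Lemma differentiable_metric_rep : differentiable (bilin_rep (chart_at p) g) (base p).
Proof. exact: (hg.1 _ (chart_at_atlas p) [::] _ (base_target p)). Qed.

Lemma metric_rep_sym y u v : bil (gl y) u v = bil (gl y) v u.
Proof. by rewrite /gl !bil_bilin_rep riem_sym. Qed.

Lemma derive_metric_sym x u v : bil (g1 x) u v = bil (g1 x) v u.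
Proof.
have glT : (fun y => (gl y)^T) = gl.
  by apply/funext => y; apply: bil_eq => s t; rewrite bil_tr; exact: metric_rep_sym.
have dT := derive_trmx x differentiable_metric_rep; rewrite -/gl glT g1E in dT.
rewrite -bil_tr; exact: (congr1 (fun A => bil A v u) (esym dT)).
Qed.

Lemma derive_metric_linear a x y u v :
  bil (g1 (a *: x + y)) u v = a * bil (g1 x) u v + bil (g1 y) u v.
Proof.
rewrite -!g1E (derive_linear _ _ _ differentiable_metric_rep) bilD; congr (_ + _).
by rewrite /bil -scalemxAr -scalemxAl mxE.
Qed.

(** The existential hides the matrices behind a trilinear form [D], whose values are then atoms for
    [ring]. *)
Lemma derive_metric_props : exists D : 'rV[R]_m -> 'rV[R]_m -> 'rV[R]_m -> R,
  [/\ forall x u v, bil (g1 x) u v = D x u v, forall x u v, D x u v = D x v u,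
      forall a x y u v, D (a *: x + y) u v = a * D x u v + D y u v,
      forall a x u u' v, D x (a *: u + u') v = a * D x u v + D x u' v &
      forall a x u u' v, D x v (a *: u + u') = a * D x v u + D x v u'].
Proof.
exists (fun x u v => bil (g1 x) u v); split => //.
- exact: derive_metric_sym.
- exact: derive_metric_linear.
- by move=> *; rewrite bilDl bilZl.
- by move=> *; rewrite bilDr bilZr.
Qed.

(** Koszul's formula for coordinate fields: lowering the index cancels the inverse metric in
    [christoffel]. As g is nondegenerate, symmetry and linearity of the connection terms can be read
    off from it without indices. *)
Lemma christoffel_term_metric u v w :
  bil (g p) (christoffel_term g p u v) w
  = 2^-1 * (bil (g1 u) v w + bil (g1 v) u w - bil (g1 w) u v).
Proof.
have [D [DE Ds D1 Dl Dr]] := derive_metric_props.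
pose t x y z := 2^-1 * (D x y z + D y x z - D z x y).
have -> : 2^-1 * (bil (g1 u) v w + bil (g1 v) u w - bil (g1 w) u v) = t u v w.
  by rewrite !DE.
have [t1 t2 t3] : [/\ forall a x x' y z, t (a *: x + x') y z = a * t x y z + t x' y z,
    forall a x y y' z, t x (a *: y + y') z = a * t x y z + t x y' z &
    forall a x y z z', t x y (a *: z + z') = a * t x y z + t x y z'].
  by rewrite /t; split=> *; rewrite !(D1, Dl, Dr); ring.
pose e (i : 'I_m) : 'rV[R]_m := delta_mx 0 i.
have entry (A : 'M[R]_m) i j : bil A (e i) (e j) = A i j.
  by rewrite /bil /e trmx_delta -rowE -colE !mxE.
have Dc x i j : 'D_x (fun y => gl y i j) b = D x (e i) (e j).
  by rewrite (derive_coord _ _ _ differentiable_metric_rep) g1E -entry DE.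
have cE i j s : christoffel g p i j s = \sum_l invmx (g p) s l * t (e i) (e j) (e l).
  rewrite /christoffel mulr_sumr; apply: eq_bigr => l _.
  rewrite mulrCA; congr (_ * (_ * (_ + _ - _))); exact: Dc.
pose k : 'rV[R]_m := \row_l \sum_i \sum_j u 0 i * v 0 j * t (e i) (e j) (e l).
have gu : g p \in unitmx by apply: posdef_unit => x; exact: riem_pos.
have gT : (g p)^T = g p by apply: bil_eq => x y; rewrite bil_tr riem_sym.
have -> : christoffel_term g p u v = k *m invmx (g p).
  apply/rowP => s; rewrite !mxE.
  under [RHS]eq_bigr => l _.
    rewrite mxE mulr_suml.
    under eq_bigr => i _ do rewrite mulr_suml.
  over.
  rewrite [RHS]exchange_big/=; apply: eq_bigr => i _.
  rewrite [RHS]exchange_big/=; apply: eq_bigr => j _.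
  rewrite cE mulr_sumr; apply: eq_bigr => l _.
  have -> : invmx (g p) l s = invmx (g p) s l by rewrite -{1}gT -trmx_inv mxE.
  ring.
rewrite /bil mulmxKV// mxE.
under eq_bigr => l _ do rewrite !mxE.
rewrite (linear_rV_sum (f := fun z => t u v z)); last by move=> *; exact: t3.
apply: eq_bigr => l _; rewrite mulrC; congr (_ * _).
rewrite (linear_rV_sum (f := fun x => t x v (e l))); last by move=> *; exact: t1.
apply: eq_bigr => i _.
rewrite (linear_rV_sum (f := fun y => t (e i) y (e l))); last by move=> *; exact: t2.
by rewrite mulr_sumr; apply: eq_bigr => j _; rewrite mulrA.
Qed.

Lemma christoffel_termC u v : christoffel_term g p u v = christoffel_term g p v u.
Proof.
apply: (@riem_inj p) => w; rewrite !christoffel_term_metric.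
have [D [DE Ds _ _ _]] := derive_metric_props.
by rewrite !DE (Ds w v u); ring.
Qed.

Lemma christoffel_term_linear u a v v' : christoffel_term g p u (a *: v + v')
  = a *: christoffel_term g p u v + christoffel_term g p u v'.
Proof.
apply: (@riem_inj p) => w; rewrite bilDl bilZl !christoffel_term_metric.
have [D [DE Ds D1 Dl Dr]] := derive_metric_props.
by rewrite !DE !(D1, Dl, Dr); ring.
Qed.

Lemma christoffel_term_linearl a u u' v : christoffel_term g p (a *: u + u') v
  = a *: christoffel_term g p u v + christoffel_term g p u' v.
Proof.
by rewrite christoffel_termC christoffel_term_linear !(christoffel_termC v).
Qed.

Lemma christoffel_term0 u : christoffel_term g p u 0 = 0.
Proof.
have := christoffel_term_linear u 1 0 0; rewrite !scale1r addr0.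
by move/eqP; rewrite eq_sym -subr_eq0 addrK => /eqP.
Qed.

(** In the sum of the two Koszul expressions the terms differentiating along [u] and [v] cancel. *)
Lemma derive_metric x u v : bil (g1 x) u v
  = bil (g p) (christoffel_term g p x u) v + bil (g p) u (christoffel_term g p x v).
Proof.
rewrite (riem_sym p u) !christoffel_term_metric.
have [D [DE Ds _ _ _]] := derive_metric_props.
by rewrite !DE (Ds x v u); field.
Qed.

End Christoffel.

(** * Test fields that are constant to first order at a point *)

Section FlatFields.
Local Opaque diff derive.
Variables (R : realType) (m : nat) (M : manifold R m).

(** A constant field of the chart, cut off by a bump. Closedness and normality are stated for global
    smooth fields; tested on these, whose brackets vanish at [p], they become algebraic identities
    between first derivatives at [p]. *)
Lemma exists_flat_field (p : M) (u : 'rV[R]_m) : exists X : vector_field M,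
  [/\ smooth_vector_field X, X p = u,
      differentiable (vec_rep (chart_at p) X) (base p) &
      forall x, 'D_x (vec_rep (chart_at p) X) (base p) = 0].
Proof.
have cp := chart_at_atlas p.
have [X [f [sX fb [df Df] Xrep _]]] :=
  exists_extension (w := fun=> u) cp (@open_target _ _ _ (chart_at p))
    (@subset_refl _ _) (base_target p) (fun k => Ck_cst k _ u).
have near_rep : \forall y \near base p, f y *: u = vec_rep (chart_at p) X y.
  by apply: (near_open (@open_target _ _ _ (chart_at p)) (base_target p)) => y /Xrep.
have dfu : differentiable (fun y => f y *: u) (base p) by exact: differentiableZl.
exists X; split => //.
- by rewrite -vec_rep_base Xrep ?fb ?scale1r//; exact: base_target.
- exact: differentiable_near near_rep dfu.
- move=> x; rewrite -(near_eq_derive x near_rep).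
  have -> : 'D_x (fun y => f y *: u) (base p) = 'D_x f (base p) *: u.
    by rewrite deriveE// (deriveE x df) diffZl.
  by rewrite Df scale0r.
Qed.

Lemma dir_deriv_near (p : M) x (h : M -> R) (f : 'rV[R]_m -> R) :
  (forall y, target (chart_at p) y -> h (of_coord (chart_at p) y) = f y) ->
  dir_deriv x h p = 'D_x f (base p).
Proof.
move=> hf; apply: near_eq_derive.
exact: (near_open (@open_target _ _ _ (chart_at p)) (base_target p)).
Qed.

Lemma derive_vec_rep_endo (p : M) (A : endo_field M) (X : vector_field M) x :
  differentiable (endo_rep (chart_at p) A) (base p) ->
  differentiable (vec_rep (chart_at p) X) (base p) ->
  'D_x (vec_rep (chart_at p) (endo_app A X)) (base p)
  = 'D_x (vec_rep (chart_at p) X) (base p) *m A p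
    + X p *m 'D_x (endo_rep (chart_at p) A) (base p).
Proof.
move=> dA dX; have cp := chart_at_atlas p.
have E := derive_mulmx x dX dA; rewrite vec_rep_base endo_rep_base in E.
rewrite -E.
apply: near_eq_derive.
apply: (near_open (@open_target _ _ _ (chart_at p)) (base_target p)) => y cy.
exact: vec_rep_endo.
Qed.

End FlatFields.

(** * Parallelism of the cosymplectic structure *)

Section Cosymplectic.
Local Opaque diff derive.
Variables (R : realType) (m : nat) (M : manifold R m).
Variables (phi : endo_field M) (xi : vector_field M) (eta : one_form M) (g : bilin_field M).

Lemma derive_mulmx_cstl (V : normedModType R) a b c (v : 'M[R]_(a, b))
    (A : V -> 'M[R]_(b, c)) x w : differentiable A x ->
  differentiable (fun y => v *m A y) x /\ 'D_w (fun y => v *m A y) x = v *m 'D_w A x.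
Proof.
move=> dA; have dv : differentiable (fun _ : V => v) x by exact: differentiable_cst.
split; first exact: differentiable_mulmx.
by rewrite (derive_mulmx w dv dA) derive_cst mul0mx add0r.
Qed.

Hypothesis hM : cosymplectic phi xi eta g.

Lemma cosymplectic_metric : riemannian_metric g.
Proof. by case: hM => -[]. Qed.

Lemma acm_phi2 q u : u *m phi q *m phi q = - u + ev1 eta q u *: xi q.
Proof. by case: hM => -[_ _ _ _ /(_ q)[]]. Qed.

Lemma acm_phixi q : xi q *m phi q = 0.
Proof. by case: hM => -[_ _ _ _ /(_ q)[]]. Qed.

Lemma acm_etaphi q u : ev1 eta q (u *m phi q) = 0.
Proof. by case: hM => -[_ _ _ _ /(_ q)[]]. Qed.

Lemma acm_etaxi q : ev1 eta q (xi q) = 1.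
Proof. by case: hM => -[_ _ _ _ /(_ q)[]]. Qed.

Lemma acm_gphi q u v :
  bil (g q) (u *m phi q) (v *m phi q) = bil (g q) u v - ev1 eta q u * ev1 eta q v.
Proof. by case: hM => -[_ _ _ _ /(_ q)[_ _ _ _ [H _]]] _ _ _; exact: H. Qed.

Lemma acm_eta q u : ev1 eta q u = bil (g q) u (xi q).
Proof. by case: hM => -[_ _ _ _ /(_ q)[_ _ _ _ [_ H]]] _ _ _; exact: H. Qed.

Lemma acm_skew q u v : bil (g q) (u *m phi q) v = - bil (g q) u (v *m phi q).
Proof.
have := acm_gphi q (u *m phi q) v.
rewrite acm_phi2 acm_etaphi bilDl bilNl bilZl (riem_sym cosymplectic_metric q (xi q)).
by rewrite -acm_eta acm_etaphi; lra.
Qed.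

Variable p : M.
Let c := chart_at p.
Let b := base p.
Let cp : atlas c := chart_at_atlas p.
Let bt : target c b := base_target p.
Let gl := bilin_rep c g.
Let fl := endo_rep c phi.
Let xl := vec_rep c xi.
Let el := form_rep c eta.

Lemma differentiable_endo_rep : differentiable (endo_rep (chart_at p) phi) (base p).
Proof. by case: hM => -[s _ _ _ _] _ _ _; exact: (s c cp [::] b bt). Qed.

Lemma differentiable_xi_rep : differentiable (vec_rep (chart_at p) xi) (base p).
Proof. by case: hM => -[_ s _ _ _] _ _ _; exact: (s c cp [::] b bt). Qed.

Lemma differentiable_eta_rep : differentiable (form_rep (chart_at p) eta) (base p).
Proof. by case: hM => -[_ _ s _ _] _ _ _; exact: (s c cp [::] b bt). Qed.

Let df := differentiable_endo_rep.
Let dx := differentiable_xi_rep.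
Let de := differentiable_eta_rep.
Let dg := differentiable_metric_rep cosymplectic_metric p.

Lemma endo_rep_mul y (u : 'rV[R]_m) : target c y ->
  u *m fl y *m tan_from c (of_coord c y)
  = u *m tan_from c (of_coord c y) *m phi (of_coord c y).
Proof. by move=> cy; rewrite -mulmxA (endo_rep_from phi cp cy) mulmxA. Qed.

Lemma form_rep_mul y u :
  (u *m el y) 0 0 = ev1 eta (of_coord c y) (u *m tan_from c (of_coord c y)).
Proof. by rewrite /ev1 -mulmxA. Qed.

Lemma tan_from_inj q (u v : 'rV[R]_m) : source c q ->
  u *m tan_from c q = v *m tan_from c q -> u = v.
Proof.
move=> cq; have := tan_fromK cp cq; move: (tan_from c q) (tan_to c q) => S T ST E.
by rewrite -(mulmx1 u) -(mulmx1 v) -ST !mulmxA E.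
Qed.

(** This identity and the next three are carried over to the whole chart domain, not just the base
    point, because they are differentiated below. *)
Lemma rep_skew y u v : target c y -> bil (gl y) (u *m fl y) v = - bil (gl y) u (v *m fl y).
Proof. by move=> cy; rewrite !bil_bilin_rep !(endo_rep_mul _ cy) acm_skew. Qed.

Lemma rep_phi2 y (u : 'rV[R]_m) : target c y -> u *m fl y *m fl y = - u + u *m el y *m xl y.
Proof.
move=> cy; apply: (tan_from_inj (of_coord_source cy)).
rewrite !(endo_rep_mul _ cy) acm_phi2 mulmxDl mulNmx; congr (_ + _).
rewrite [u *m el y]mx11_scalar mul_scalar_mx form_rep_mul -scalemxAl.
by rewrite (vec_rep_from xi cp cy).
Qed.

Lemma rep_eta y u : target c y -> (u *m el y) 0 0 = bil (gl y) u (xl y).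
Proof.
by move=> cy; rewrite form_rep_mul bil_bilin_rep (vec_rep_from xi cp cy) acm_eta.
Qed.

Lemma rep_xixi y : target c y -> bil (gl y) (xl y) (xl y) = 1.
Proof.
by move=> cy; rewrite bil_bilin_rep (vec_rep_from xi cp cy) -acm_eta acm_etaxi.
Qed.

Lemma rep_form (Y Z : vector_field M) y : target c y ->
  bil (gl y) (vec_rep c Y y) (vec_rep c Z y *m fl y)
  = bil (g (of_coord c y)) (Y (of_coord c y)) (Z (of_coord c y) *m phi (of_coord c y)).
Proof.
move=> cy; rewrite bil_bilin_rep.
have E1 := vec_rep_from Y cp cy.
have E2 := etrans (endo_rep_mul (vec_rep c Z y) cy)
  (congr1 (mulmx^~ (phi (of_coord c y))) (vec_rep_from Z cp cy)).
exact: congr2 E1 E2.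
Qed.

Let near_target (P : 'rV[R]_m -> Prop) (H : forall y, target c y -> P y) :
  \forall y \near b, P y := near_open (@open_target _ _ _ c) bt H.

Section Derivatives.
Variables (G1 F1 : 'rV[R]_m -> 'M[R]_m) (X1 : 'rV[R]_m -> 'rV[R]_m)
  (e1 : 'rV[R]_m -> 'cV[R]_m).
Hypothesis G1E : forall x, 'D_x (bilin_rep (chart_at p) g) (base p) = G1 x.
Hypothesis F1E : forall x, 'D_x (endo_rep (chart_at p) phi) (base p) = F1 x.
Hypothesis X1E : forall x, 'D_x (vec_rep (chart_at p) xi) (base p) = X1 x.
Hypothesis e1E : forall x, 'D_x (form_rep (chart_at p) eta) (base p) = e1 x.

Let glb : bilin_rep (chart_at p) g (base p) = g p := bilin_rep_base g p.
Let flb : endo_rep (chart_at p) phi (base p) = phi p := endo_rep_base phi p.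
Let xlb : vec_rep (chart_at p) xi (base p) = xi p := vec_rep_base xi p.
Let elb : form_rep (chart_at p) eta (base p) = eta p := form_rep_base eta p.

Lemma derive_bil_endo x (Y Z : 'rV[R]_m -> 'rV[R]_m) :
  differentiable Y b -> differentiable Z b -> 'D_x Y b = 0 -> 'D_x Z b = 0 ->
  differentiable (fun y => bil (gl y) (Y y) (Z y *m fl y)) b /\
  'D_x (fun y => bil (gl y) (Y y) (Z y *m fl y)) b
  = bil (G1 x) (Y b) (Z b *m phi p) + bil (g p) (Y b) (Z b *m F1 x).
Proof.
move=> dY dZ DY DZ; have dZf := differentiable_mulmx dZ df.
split; first exact: differentiable_bil dg dY dZf.
rewrite (derive_bil x dg dY dZf) (derive_mulmx x dZ df) DY DZ.
by rewrite glb flb G1E F1E mul0mx add0r bil0l addr0.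
Qed.

Lemma derive_skew x u v : bil (G1 x) u (v *m phi p) + bil (g p) u (v *m F1 x)
  + bil (G1 x) (u *m phi p) v + bil (g p) (u *m F1 x) v = 0.
Proof.
have [dc dc'] : differentiable (fun _ : 'rV[R]_m => u) b /\
    differentiable (fun _ : 'rV[R]_m => v) b by split; exact: differentiable_cst.
have [d1 D1] := derive_bil_endo dc dc' (derive_cst _ _ x) (derive_cst _ _ x).
have [duf Duf] := derive_mulmx_cstl u x df.
have d2 := differentiable_bil dg duf dc'.
have D2 := derive_bil x dg duf dc'.
rewrite Duf (derive_cst v) glb flb G1E F1E bil0r addr0 in D2.
have : 'D_x ((fun y => bil (gl y) u (v *m fl y)) + (fun y => bil (gl y) (u *m fl y) v)) b = 0.
  rewrite -(derive_cst (0 : R) b x); apply: near_eq_derive; apply: near_target => y cy.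
  by rewrite /= !fctE rep_skew// addrN.
rewrite deriveD; [|exact: diff_derivable|exact: diff_derivable].
by rewrite D1 D2 !addrA.
Qed.

Lemma derive_phi2 x u : u *m F1 x *m phi p + u *m phi p *m F1 x
  = (u *m e1 x) 0 0 *: xi p + ev1 eta p u *: X1 x.
Proof.
have [duf Duf] := derive_mulmx_cstl u x df.
have [due Due] := derive_mulmx_cstl u x de.
have D1 := derive_mulmx x duf df.
have D2 := derive_mulmx x due dx.
have dex := differentiable_mulmx due dx.
rewrite Duf F1E flb in D1; rewrite Due e1E X1E xlb elb in D2.
have du : differentiable (fun _ : 'rV[R]_m => - u) b by exact: differentiable_cst.
rewrite -D1.
have -> : 'D_x (fun y => u *m endo_rep (chart_at p) phi y *m endo_rep (chart_at p) phi y) (base p)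
   = 'D_x ((fun _ : 'rV[R]_m => - u) + (fun y => u *m el y *m xl y)) b.
  apply: near_eq_derive; apply: near_target => y cy.
  exact: rep_phi2.
rewrite deriveD; [|exact: diff_derivable|exact: diff_derivable].
rewrite (derive_cst (- u)) add0r D2.
rewrite [u *m e1 x]mx11_scalar [u *m eta p]mx11_scalar !mul_scalar_mx.
by rewrite -!mx11_scalar.
Qed.

Lemma derive_eta x u : (u *m e1 x) 0 0 = bil (G1 x) u (xi p) + bil (g p) u (X1 x).
Proof.
have dc : differentiable (fun _ : 'rV[R]_m => u) b by exact: differentiable_cst.
have [due Due] := derive_mulmx_cstl u x de.
have D1 := derive_bil x dg dc dx.
rewrite (derive_cst u) glb xlb G1E X1E bil0l addr0 in D1.
rewrite -D1 -e1E -Due -derive_coord; last exact: due.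
by apply: near_eq_derive; apply: near_target => y cy; exact: rep_eta.
Qed.

Lemma derive_xixi x : bil (G1 x) (xi p) (xi p) + 2 * bil (g p) (X1 x) (xi p) = 0.
Proof.
have D1 := derive_bil x dg dx dx; rewrite glb xlb G1E X1E in D1.
have : 'D_x (fun y => bil (gl y) (xl y) (xl y)) b = 0.
  rewrite -(derive_cst (1 : R) b x); apply: near_eq_derive; apply: near_target => y cy.
  exact: rep_xixi.
rewrite D1 (riem_sym cosymplectic_metric p (xi p)).
by move: (bil _ _ _) (bil _ _ _) => s t; lra.
Qed.

Section Fields.
Variables (X Y : vector_field M).
Hypothesis dX : differentiable (vec_rep (chart_at p) X) (base p).
Hypothesis dY : differentiable (vec_rep (chart_at p) Y) (base p).
Hypothesis DX : forall x, 'D_x (vec_rep (chart_at p) X) (base p) = 0.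
Hypothesis DY : forall x, 'D_x (vec_rep (chart_at p) Y) (base p) = 0.

Lemma flat_bracket : lie_bracket X Y p = 0.
Proof. by rewrite /lie_bracket DX DY subrr. Qed.

Lemma flat_bracket_endo : lie_bracket (endo_app phi X) (endo_app phi Y) p
  = Y p *m F1 (X p *m phi p) - X p *m F1 (Y p *m phi p).
Proof.
rewrite /lie_bracket (derive_vec_rep_endo _ df dX) (derive_vec_rep_endo _ df dY).
by rewrite DX DY !F1E !mul0mx !add0r.
Qed.

Lemma flat_bracket_endol : lie_bracket (endo_app phi X) Y p = - (X p *m F1 (Y p)).
Proof.
rewrite /lie_bracket (derive_vec_rep_endo _ df dX) DX DY !F1E.
by rewrite mul0mx sub0r add0r.
Qed.

Lemma flat_bracket_endor : lie_bracket X (endo_app phi Y) p = Y p *m F1 (X p).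
Proof.
rewrite /lie_bracket (derive_vec_rep_endo _ df dY) DX DY !F1E.
by rewrite mul0mx add0r subr0.
Qed.

Lemma flat_dir_eta x : dir_deriv x (fun q => ev1 eta q (Y q)) p = (Y p *m e1 x) 0 0.
Proof.
rewrite (dir_deriv_near x (f := fun y => (vec_rep c Y y *m el y) 0 0)); last first.
  by move=> y cy; rewrite form_rep_mul (vec_rep_from Y cp cy).
rewrite (derive_coord _ _ _ (differentiable_mulmx dY de)) (derive_mulmx _ dY de).
by rewrite DY e1E mul0mx add0r vec_rep_base.
Qed.

Lemma flat_dir_form x : dir_deriv x (fun q => ev2 (fundamental_form phi g) q (X q) (Y q)) p
  = bil (G1 x) (X p) (Y p *m phi p) + bil (g p) (X p) (Y p *m F1 x).
Proof.
have [_ D1] := derive_bil_endo dX dY (DX x) (DY x).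
rewrite !vec_rep_base in D1; rewrite -D1; apply: dir_deriv_near => y cy.
rewrite (rep_form _ _ cy).
rewrite -[LHS]/(bil (g (of_coord c y) *m (phi (of_coord c y))^T) _ _).
by rewrite bil_mulr trmxK.
Qed.

End Fields.
End Derivatives.

Lemma cosymplectic_parallel :
  (forall x u, u *m 'D_x (endo_rep (chart_at p) phi) (base p)
     + christoffel_term g p x (u *m phi p) - christoffel_term g p x u *m phi p = 0) /\
  (forall x, 'D_x (vec_rep (chart_at p) xi) (base p) + christoffel_term g p x (xi p) = 0).
Proof.
have hg := cosymplectic_metric.
(* The derivatives are generalised to variables, which keeps unification from unfolding them. *)
have [G1 G1E] : exists G1 : 'rV[R]_m -> 'M[R]_m,
    forall x, 'D_x (bilin_rep (chart_at p) g) (base p) = G1 x by eexists.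
have [F1 F1E] : exists F1 : 'rV[R]_m -> 'M[R]_m,
    forall x, 'D_x (endo_rep (chart_at p) phi) (base p) = F1 x by eexists.
have [X1 X1E] : exists X1 : 'rV[R]_m -> 'rV[R]_m,
    forall x, 'D_x (vec_rep (chart_at p) xi) (base p) = X1 x by eexists.
have [e1 e1E] : exists e1 : 'rV[R]_m -> 'cV[R]_m,
    forall x, 'D_x (form_rep (chart_at p) eta) (base p) = e1 x by eexists.
have F1l a x y : F1 (a *: x + y) = a *: F1 x + F1 y.
  by rewrite -!F1E; exact: derive_linear df.
have deta u v : (v *m e1 u) 0 0 = (u *m e1 v) 0 0.
  have [X [sX Xp dX DX]] := exists_flat_field p u.
  have [Y [sY Yp dY DY]] := exists_flat_field p v.
  case: hM => _ _ /(_ X Y sX sY p) + _.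
  rewrite /ext_d1 (flat_dir_eta e1E dX DX) (flat_dir_eta e1E dY DY).
  have ev10 : ev1 eta p 0 = 0 by rewrite /ev1 mul0mx mxE.
  rewrite (flat_bracket DX DY) Xp Yp ev10.
  by move: ((v *m e1 u) 0 0) ((u *m e1 v) 0 0) => s t; lra.
have cyc x u v : (bil (G1 x) u (v *m phi p) + bil (g p) u (v *m F1 x))
    + (bil (G1 u) v (x *m phi p) + bil (g p) v (x *m F1 u))
    + (bil (G1 v) x (u *m phi p) + bil (g p) x (u *m F1 v)) = 0.
  have [X [sX Xp dX DX]] := exists_flat_field p x.
  have [Y [sY Yp dY DY]] := exists_flat_field p u.
  have [Z [sZ Zp dZ DZ]] := exists_flat_field p v.
  case: hM => _ _ _ /(_ X Y Z sX sY sZ p).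
  rewrite /ext_d2 (flat_dir_form G1E F1E dY dZ DY DZ) (flat_dir_form G1E F1E dZ dX DZ DX).
  rewrite (flat_dir_form G1E F1E dX dY DX DY).
  rewrite (flat_bracket DX DY) (flat_bracket DY DZ) (flat_bracket DZ DX) Xp Yp Zp.
  rewrite -![ev2 _ _ 0 _]/(bil _ 0 _) !bil0l !subr0.
  by move=> /eqP; rewrite mulf_eq0 invr_eq0 pnatr_eq0 => /eqP.
have nij u v : v *m F1 (u *m phi p) - u *m F1 (v *m phi p)
    + u *m F1 v *m phi p - v *m F1 u *m phi p = 0.
  have [X [sX Xp dX DX]] := exists_flat_field p u.
  have [Y [sY Yp dY DY]] := exists_flat_field p v.
  case: hM => _ /(_ X Y sX sY p) + /(_ X Y sX sY p) cl _.
  (* Since eta is closed, normality leaves only the vanishing of the Nijenhuis tensor. *)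
  rewrite cl mulr0 scale0r addr0 /nijenhuis /endo_app.
  rewrite (flat_bracket DX DY) (flat_bracket_endo F1E dX dY DX DY).
  rewrite (flat_bracket_endol F1E dX DX DY) (flat_bracket_endor F1E dY DX DY).
  by rewrite Xp Yp !mul0mx add0r mulNmx opprK.
suff [H1 H2] : (forall x u, u *m F1 x + christoffel_term g p x (u *m phi p)
      - christoffel_term g p x u *m phi p = 0) /\
    (forall x, X1 x + christoffel_term g p x (xi p) = 0).
  by split=> [x u|x]; [rewrite F1E|rewrite X1E].
apply: (@cosymplectic_parallel_algebra R _ (bil (g p)) (fun x => bil (G1 x))
  (fun u => u *m phi p) (fun x u => u *m F1 x) (xi p) X1 (ev1 eta p)
  (fun x u => (u *m e1 x) 0 0) (christoffel_term g p)).
- exact: riem_sym hg p.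
- by move=> *; rewrite bilDl bilZl.
- by move=> a H; apply: (riem_inj hg (q := p)) => w; rewrite H bil0l.
- by move=> *; rewrite mulmxDl scalemxAl.
- exact: acm_phi2.
- exact: acm_phixi.
- exact: acm_etaxi.
- exact: acm_eta.
- exact: acm_skew.
- exact: christoffel_termC hg p G1 G1E.
- exact: christoffel_term_linear hg p G1 G1E.
- by move=> a x y u; rewrite F1l mulmxDr scalemxAr.
- by move=> x a u v; rewrite mulmxDl scalemxAl.
- exact: derive_metric hg p G1 G1E.
- exact: derive_skew G1E F1E.
- exact: derive_phi2 F1E X1E e1E.
- exact: derive_eta G1E X1E e1E.
- exact: derive_xixi G1E X1E.
- exact: cyc.
- exact: nij.
- by move=> u v; exact: deta.
Qed.

End Cosymplectic.

(** * Riemannian submersions *)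

Section MapRepresentation.
Local Opaque diff derive jacobian.
Variables (R : realType) (m n : nat) (M : manifold R m) (N : manifold R n).
Variable F : M -> N.
Hypothesis sF : smooth_map F.

Definition map_rep (c : chart R m M) (d : chart R n N) : 'rV[R]_m -> 'rV[R]_n :=
  to_coord d \o F \o of_coord c.

Definition map_domain (c : chart R m M) (d : chart R n N) : set 'rV[R]_m :=
  target c `&` (F \o of_coord c) @^-1` source d.

Lemma open_map_domain c d : open (map_domain c d).
Proof.
apply: (open_target_preimage (c := c) (A := F @^-1` source d)).
by move/continuousP: sF.1; apply; exact: open_source.
Qed.

Lemma Ck_map_rep c d k : atlas c -> atlas d -> Ck k (map_domain c d) (map_rep c d).
Proof.
by move=> ac ad; apply: (smooth_onE (map_domain c d) (map_rep c d)).1; exact: sF.2.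
Qed.

Lemma differentiable_map_rep c d y : atlas c -> atlas d -> map_domain c d y ->
  differentiable (map_rep c d) y.
Proof. by move=> ac ad; exact: Ck_diff (Ck_map_rep 0 ac ad). Qed.

Lemma base_map_domain p : map_domain (chart_at p) (chart_at (F p)) (base p).
Proof.
by split; [exact: base_target|rewrite /= of_base; exact: chart_at_source].
Qed.

Lemma map_rep_base p : map_rep (chart_at p) (chart_at (F p)) (base p) = base (F p).
Proof. by rewrite /map_rep /= of_base. Qed.

Lemma of_map_rep c d y : map_domain c d y ->
  of_coord d (map_rep c d y) = F (of_coord c y).
Proof. by move=> [_ dy]; rewrite /map_rep /= to_coordK. Qed.

Lemma map_rep_target c d y : map_domain c d y -> target d (map_rep c d y).
Proof. by move=> [_ dy]; exact: to_coord_target. Qed.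

(** [tangent_map] is taken in charts that vary with the point, without any continuity; its
    expression through one pair of fixed charts is a Jacobian, which can be differentiated. *)
Lemma jacobian_map_rep c d y : atlas c -> atlas d -> map_domain c d y ->
  jacobian (map_rep c d) y = tan_from c (of_coord c y)
    *m tangent_map F (of_coord c y) *m tan_to d (F (of_coord c y)).
Proof.
move=> ac ad dy; have [cy Fy] := dy; pose q := of_coord c y.
have sq : source c q := of_coord_source cy.
have yq : to_coord c q = y := of_coordK cy.
have aq := chart_at_atlas q; have aFq := chart_at_atlas (F q).
have ocy : overlap c (chart_at q) y by split => //; exact: chart_at_source.
have tq : transition c (chart_at q) y = base q by [].
have mq := base_map_domain q.
have mqE := map_rep_base q.
have odq : overlap (chart_at (F q)) d (base (F q)).
  by split; [exact: base_target|rewrite /= of_base].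
have d1 := differentiable_transition ac aq ocy.
have d2 := differentiable_map_rep aq aFq mq.
have d3 := differentiable_transition aFq ad odq.
have d2' : differentiable (map_rep (chart_at q) (chart_at (F q)))
  (transition c (chart_at q) y) by exact: d2.
have d12 := differentiable_comp d1 d2'.
have E12 := jacobian_comp d1 d2'.
have d3' : differentiable (transition (chart_at (F q)) d)
  ((map_rep (chart_at q) (chart_at (F q)) \o transition c (chart_at q)) y).
  by rewrite /= tq mqE.
have E123 := jacobian_comp d12 d3'.
(* Near [y], F passes through the charts chosen at q and F q; the chain rule yields the three
   factors. *)
have nearE : \forall z \near y, map_rep c d z = (transition (chart_at (F q)) d
    \o (map_rep (chart_at q) (chart_at (F q)) \o transition c (chart_at q))) z.
  have oA : open (source (chart_at q) `&` F @^-1` (source (chart_at (F q)))).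
    apply: openI; first exact: open_source.
    by move/continuousP: sF.1; apply; exact: open_source.
  apply: (near_open (open_target_preimage (c := c) oA)).
    by split => //; split; exact: chart_at_source.
  move=> z [cz [z1 z2]].
  by rewrite /= /map_rep /transition /= (to_coordK z1) (to_coordK z2).
rewrite (jacobian_near nearE (differentiable_map_rep ac ad dy)) E123 E12.
rewrite /= tq mqE -/q.
have t1 : jacobian (transition c (chart_at q)) y = tan_from c q by rewrite /tan_from yq.
have t2 : jacobian (map_rep (chart_at q) (chart_at (F q))) (base q) = tangent_map F q := erefl.
have t3 : jacobian (transition (chart_at (F q)) d) (base (F q)) = tan_to d (F q) := erefl.
exact: (f_equal2 mulmx (f_equal2 mulmx t1 t2) t3).
Qed.

Lemma along_rep_push c d (Y : vector_field M) y : atlas c -> atlas d -> map_domain c d y ->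
  along_rep F c d (push F Y) y = vec_rep c Y y *m jacobian (map_rep c d) y.
Proof.
move=> ac ad dy; rewrite (jacobian_map_rep ac ad dy) /along_rep /vec_rep /push /=.
have := tan_toK ac (of_coord_source dy.1).
move: (tan_to c _) (tan_from c _) (tan_to d _) (tangent_map _ _) => A B C D AB.
by rewrite !mulmxA -(mulmxA _ A B) AB mulmx1.
Qed.

Lemma bil_map_rep c d (gN : bilin_field N) y u v : atlas c -> atlas d -> map_domain c d y ->
  let q := of_coord c y in
  bil (bilin_rep d gN (map_rep c d y)) (u *m jacobian (map_rep c d) y)
    (v *m jacobian (map_rep c d) y)
  = bil (tangent_map F q *m gN (F q) *m (tangent_map F q)^T)
    (u *m tan_from c q) (v *m tan_from c q).
Proof.
move=> ac ad dy q; rewrite bil_bilin_rep bil_pull (of_map_rep dy) -/q.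
rewrite (jacobian_map_rep ac ad dy) -/q.
have := tan_toK ad dy.2; rewrite -/q.
rewrite -[(F \o of_coord c) y]/(F q).
move: (tan_to d _) (tan_from c _) (tan_from d _) (tangent_map _ _) => A B C D AC.
by rewrite -!mulmxA AC !mulmx1 !mulmxA.
Qed.

End MapRepresentation.

(** * Covariant derivative of the pullback metric in fixed coordinates *)

Section SubmersionCalculus.
Local Opaque diff derive.
Variables (R : realType) (m n : nat) (b : 'rV[R]_m) (O : set 'rV[R]_m).
Hypotheses (oO : open O) (Ob : O b).
Variables (gl fl : 'rV[R]_m -> 'M[R]_m) (xl : 'rV[R]_m -> 'rV[R]_m)
  (Jf : 'rV[R]_m -> 'M[R]_(m, n)) (gNF : 'rV[R]_m -> 'M[R]_n) (hl : 'rV[R]_m -> 'M[R]_m).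
Hypothesis dgO : forall y, O y -> differentiable gl y.
Hypothesis dhO : forall y, O y -> differentiable hl y.
Hypotheses (df : differentiable fl b) (dx : differentiable xl b)
  (dJ : differentiable Jf b) (dG : differentiable gNF b).
Variables (g phi h : 'M[R]_m) (xi : 'rV[R]_m) (T : 'M[R]_(m, n)) (gN : 'M[R]_n).
Hypotheses (glb : gl b = g) (flb : fl b = phi) (xlb : xl b = xi) (Jfb : Jf b = T)
  (gNFb : gNF b = gN) (hlb : hl b = h).
Hypothesis bil_hl : forall y u v, bil (hl y) u v = bil (gNF y) (u *m Jf y) (v *m Jf y).
Hypothesis hl_phi : forall y u v, O y ->
  bil (hl y) (u *m fl y) v - bil (hl y) u (v *m fl y) = bil (gl y) (u *m fl y) v.
Hypothesis hl_xi : forall y u, O y -> bil (hl y) u (xl y) = bil (gl y) u (xl y).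
Hypothesis hl_le : forall y u, O y -> bil (hl y) u u <= bil (gl y) u u.
Hypothesis gs : forall u v, bil g u v = bil g v u.
Hypothesis gNs : forall u v, bil gN u v = bil gN v u.
Variables (G1 F1 H1 : 'rV[R]_m -> 'M[R]_m) (X1 : 'rV[R]_m -> 'rV[R]_m)
  (J1 : 'rV[R]_m -> 'M[R]_(m, n)) (GN1 : 'rV[R]_m -> 'M[R]_n).
Hypothesis G1E : forall x, 'D_x gl b = G1 x.
Hypothesis F1E : forall x, 'D_x fl b = F1 x.
Hypothesis X1E : forall x, 'D_x xl b = X1 x.
Hypothesis H1E : forall x, 'D_x hl b = H1 x.
Hypothesis J1E : forall x, 'D_x Jf b = J1 x.
Hypothesis GN1E : forall x, 'D_x gNF b = GN1 x.
Variables (Gam : 'rV[R]_m -> 'rV[R]_m -> 'rV[R]_m) (GamN : 'rV[R]_n -> 'rV[R]_n -> 'rV[R]_n).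
Hypothesis Gaml : forall x a u v, Gam x (a *: u + v) = a *: Gam x u + Gam x v.
Hypothesis Gaml1 : forall a x y u, Gam (a *: x + y) u = a *: Gam x u + Gam y u.
Hypothesis met : forall x u v, bil (G1 x) u v = bil g (Gam x u) v + bil g u (Gam x v).
Hypothesis metN : forall x u v, bil (GN1 x) u v
  = bil gN (GamN (x *m T) u) v + bil gN u (GamN (x *m T) v).
Hypothesis par_phi : forall x u, u *m F1 x + Gam x (u *m phi) - Gam x u *m phi = 0.
Hypothesis par_xi : forall x, X1 x + Gam x xi = 0.

Let near_O (P : 'rV[R]_m -> Prop) (H : forall y, O y -> P y) :
  \forall y \near b, P y := near_open oO Ob H.
Let dg : differentiable gl b := dgO Ob.
Let dh : differentiable hl b := dhO Ob.

(** The coordinate expression of nabla dF, as a function of tangent vectors rather than of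
    fields. *)
Definition second_form x u : 'rV[R]_n := u *m J1 x - Gam x u *m T + GamN (x *m T) (u *m T).

(* The covariant derivative of the pullback metric. *)
Definition derive_pull x u v : R := bil (H1 x) u v - bil h (Gam x u) v - bil h u (Gam x v).

Lemma bil_h_b u v : bil h u v = bil gN (u *m T) (v *m T).
Proof. by rewrite -hlb bil_hl gNFb Jfb. Qed.

Lemma pull_phi_b u v : bil h (u *m phi) v - bil h u (v *m phi) = bil g (u *m phi) v.
Proof. by rewrite -hlb -flb -glb; exact: hl_phi. Qed.

Lemma pull_xi_b u : bil h u xi = bil g u xi.
Proof. by rewrite -hlb -xlb -glb; exact: hl_xi. Qed.

Lemma derive_hl x u v : bil (H1 x) u v = bil (GN1 x) (u *m T) (v *m T)
  + bil gN (u *m J1 x) (v *m T) + bil gN (u *m T) (v *m J1 x).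
Proof.
have du : differentiable (fun _ : 'rV[R]_m => u) b by exact: differentiable_cst.
have dv : differentiable (fun _ : 'rV[R]_m => v) b by exact: differentiable_cst.
have D1 := derive_bil x dh du dv.
rewrite (derive_cst u) (derive_cst v) bil0l bil0r !addr0 H1E in D1.
rewrite -D1.
have [duJ DuJ] := derive_mulmx_cstl u x dJ.
have [dvJ DvJ] := derive_mulmx_cstl v x dJ.
have D2 := derive_bil x dG duJ dvJ.
rewrite DuJ DvJ J1E GN1E gNFb Jfb in D2.
rewrite -D2; congr ('D_x _ b).
by apply/funext => y; rewrite bil_hl.
Qed.

Lemma derive_pullE x u v : derive_pull x u v
  = bil gN (second_form x u) (v *m T) + bil gN (u *m T) (second_form x v).
Proof.
rewrite /derive_pull /second_form derive_hl metN !bil_h_b !(bilDl, bilDr, bilNl, bilNr).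
by move: (bil gN) => G; ring.
Qed.

Lemma derive_pull_sym x u v : derive_pull x u v = derive_pull x v u.
Proof. by rewrite !derive_pullE addrC; congr (_ + _); exact: gNs. Qed.

Lemma derive_pull_linearr x a u v w :
  derive_pull x w (u + a *: v) = derive_pull x w u + a * derive_pull x w v.
Proof.
rewrite /derive_pull [u + _]addrC Gaml.
rewrite !(bilDr, bilZr); move: (bil h) (bil (H1 x)) => hh HH.
by ring.
Qed.

Lemma derive_pull_linearl a x y u v :
  derive_pull (a *: x + y) u v = a * derive_pull x u v + derive_pull y u v.
Proof.
rewrite /derive_pull !Gaml1.
have -> : bil (H1 (a *: x + y)) u v = a * bil (H1 x) u v + bil (H1 y) u v.
  rewrite -!H1E (derive_linear _ _ _ dh) bilD; congr (_ + _).
  by rewrite /bil -scalemxAr -scalemxAl mxE.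
rewrite !(bilDl, bilZl, bilDr, bilZr).
move: (bil h) (bil (H1 x)) (bil (H1 y)) => hh HH HH'.
by ring.
Qed.

(** The relation [hl_phi] is differentiated. As phi and g are parallel, its right-hand side has zero
    covariant derivative; the leftover Christoffel terms cancel by the same relation at the base
    point. *)
Lemma derive_pull_phi x u v : derive_pull x (u *m phi) v = derive_pull x u (v *m phi).
Proof.
have du : differentiable (fun _ : 'rV[R]_m => u) b by exact: differentiable_cst.
have dv : differentiable (fun _ : 'rV[R]_m => v) b by exact: differentiable_cst.
have [duf Duf] := derive_mulmx_cstl u x df.
have [dvf Dvf] := derive_mulmx_cstl v x df.
have D1 := derive_bil x dh duf dv.
have D2 := derive_bil x dh du dvf.
have D3 := derive_bil x dg duf dv.
have b1 := differentiable_bil dh duf dv.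
have b2 := differentiable_bil dh du dvf.
rewrite (derive_cst v) bil0r addr0 H1E Duf F1E flb hlb in D1.
rewrite (derive_cst u) bil0l addr0 H1E Dvf F1E flb hlb in D2.
rewrite (derive_cst v) bil0r addr0 G1E Duf F1E flb glb in D3.
have E : bil (H1 x) (u *m phi) v + bil h (u *m F1 x) v
  - (bil (H1 x) u (v *m phi) + bil h u (v *m F1 x))
  = bil (G1 x) (u *m phi) v + bil g (u *m F1 x) v.
  rewrite -D1 -D2 -D3 -deriveB; [|exact: diff_derivable|exact: diff_derivable].
  apply: near_eq_derive; apply: near_O => y Oy.
  by rewrite !fctE /=; exact: hl_phi.
have uF w : w *m F1 x = Gam x w *m phi - Gam x (w *m phi).
  have /eqP := par_phi x w.
  by rewrite subr_eq0 => /eqP <-; rewrite addrK.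
have q1 := pull_phi_b (Gam x u) v.
have q2 := pull_phi_b u (Gam x v).
rewrite !uF !(bilDl, bilDr, bilNl, bilNr) met in E.
rewrite /derive_pull; move: E q1 q2.
move: (bil g) (bil h) (bil (H1 x)) => gg hh HH.
by move=> E q1 q2; lra.
Qed.

Lemma derive_pull_xi x u : derive_pull x u xi = 0.
Proof.
have du : differentiable (fun _ : 'rV[R]_m => u) b by exact: differentiable_cst.
have D1 := derive_bil x dh du dx.
have D2 := derive_bil x dg du dx.
rewrite (derive_cst u) bil0l addr0 H1E X1E xlb hlb in D1.
rewrite (derive_cst u) bil0l addr0 G1E X1E xlb glb in D2.
have E : bil (H1 x) u xi + bil h u (X1 x) = bil (G1 x) u xi + bil g u (X1 x).
  rewrite -D1 -D2; apply: near_eq_derive; apply: near_O => y Oy.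
  exact: hl_xi.
have XE : X1 x = - Gam x xi.
  by have /eqP := par_xi x; rewrite addr_eq0 => /eqP.
have q1 := pull_xi_b (Gam x u).
rewrite XE !(bilDl, bilDr, bilNl, bilNr) met in E.
rewrite /derive_pull; move: E q1.
move: (bil g) (bil h) (bil (H1 x)) => gg hh HH.
by move=> E q1; lra.
Qed.

Variable hor : 'rV[R]_m -> Prop.
Hypothesis hor_add : forall u v, hor u -> hor v -> hor (u + v).
Hypothesis pull_hor_b : forall u v, hor u -> bil h u v = bil g u v.

(** On the diagonal, [w] is constant in coordinates and horizontal at [b]: there g(w, w) - h(w, w)
    reaches its minimum 0, so its derivative vanishes. The Christoffel terms agree because h and g
    coincide once one argument is horizontal. The general case is polarisation. *)
Lemma derive_pull_hor x y z : hor y -> hor z ->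
  derive_pull x y z = 0.
Proof.
have diag w : hor w -> derive_pull x w w = 0.
  move=> hw.
  have dw : differentiable (fun _ : 'rV[R]_m => w) b by exact: differentiable_cst.
  have D1 := derive_bil x dh dw dw.
  have D2 := derive_bil x dg dw dw.
  rewrite (derive_cst w) bil0l bil0r !addr0 H1E in D1.
  rewrite (derive_cst w) bil0l bil0r !addr0 G1E in D2.
  have E : bil (G1 x) w w - bil (H1 x) w w = 0.
    rewrite -D1 -D2.
    have B1 s : differentiable gl s -> differentiable (fun y => bil (gl y) w w) s.
      by move=> ds; apply: differentiable_bil => //; exact: differentiable_cst.
    have B2 s : differentiable hl s -> differentiable (fun y => bil (hl y) w w) s.
      by move=> ds; apply: differentiable_bil => //; exact: differentiable_cst.
    rewrite -deriveB; [|exact: diff_derivable (B1 _ dg)|exact: diff_derivable (B2 _ dh)].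
    apply: derive_min0.
    - apply: near_O => s Os; apply: differentiableB.
        by apply: B1; exact: dgO.
      by apply: B2; exact: dhO.
    - apply: near_O => s Os; rewrite !fctE /= subr_ge0.
      exact: hl_le.
    - by rewrite !fctE /= hlb glb (pull_hor_b _ hw) subrr.
  have q1 := pull_hor_b (Gam x w) hw.
  have q2 : bil h (Gam x w) w = bil h w (Gam x w).
    by rewrite !bil_h_b; exact: gNs.
  rewrite met (gs (Gam x w) w) in E.
    rewrite /derive_pull; move: E q1 q2.
  move: (bil g) (bil h) (bil (H1 x)) => gg hh HH.
  by move=> E q1 q2; lra.
move=> hy hz; have := diag _ (hor_add hy hz).
have := diag _ hy; have := diag _ hz; have := derive_pull_sym x y z.
have KD w u v : derive_pull x w (u + v) = derive_pull x w u + derive_pull x w v.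
  by rewrite -{1}(scale1r v) derive_pull_linearr mul1r.
rewrite KD (derive_pull_sym x (y + z) y) (derive_pull_sym x (y + z) z) !KD.
move: (derive_pull x) => K.
by lra.
Qed.

End SubmersionCalculus.

(** * The second fundamental form of the submersion *)

Section Submersion.
Local Opaque diff derive jacobian.
Variables (R : realType) (m n : nat) (M : manifold R m) (N : manifold R n).
Variables (phi : endo_field M) (xi : vector_field M) (eta : one_form M)
  (gM : bilin_field M) (gN : bilin_field N) (F : M -> N).
Hypothesis hM : cosymplectic phi xi eta gM.
Hypothesis hN : riemannian_metric gN.
Hypothesis hF : riemannian_submersion gM gN F.
Hypothesis hsplit : forall p, (horizontal gM F p == vertical F p *m phi p + xi p)%MS.

Let hg : riemannian_metric gM := cosymplectic_metric hM.
Let gs q := riem_sym hg q.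
Let gp q := @riem_pos _ _ _ _ hg q.
Let gNs q := riem_sym hN q.
Let gNp q := @riem_pos _ _ _ _ hN q.

Lemma submersion_smooth : smooth_map F. Proof. by case: hF. Qed.
Let sF := submersion_smooth.

Lemma submersion_isom q u : (u <= kermx (gM q *m (kermx (tangent_map F q))^T))%MS ->
  bil (gN (F q)) (u *m tangent_map F q) (u *m tangent_map F q) = bil (gM q) u u.
Proof. by case: hF => _ _ _ H; exact: H. Qed.

Lemma submersion_rank q : \rank (tangent_map F q) = n.
Proof. by case: hF. Qed.

Definition pull_metric q := tangent_map F q *m gN (F q) *m (tangent_map F q)^T.

Lemma pull_phi q u v : bil (pull_metric q) (u *m phi q) v - bil (pull_metric q) u (v *m phi q)
  = bil (gM q) (u *m phi q) v.
Proof.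
exact: (bil_h_phi (@gs q) (@gp q) (@gNs (F q)) (@submersion_isom q)
  (acm_phi2 hM q) (acm_phixi hM q) (acm_etaphi hM q) (acm_gphi hM q) (acm_eta hM q)
  (hsplit q)).
Qed.

Lemma pull_xi q u : bil (pull_metric q) u (xi q) = bil (gM q) u (xi q).
Proof.
rewrite -(acm_eta hM).
exact: (bil_h_xi (@gs q) (@gp q) (@gNs (F q)) (@submersion_isom q)
  (acm_eta hM q) (hsplit q)).
Qed.

Lemma pull_le q u : bil (pull_metric q) u u <= bil (gM q) u u.
Proof. exact: (bil_h_le (@gs q) (@gp q) (@gNs (F q)) (@submersion_isom q)). Qed.

Lemma pull_hor q u v : (u <= horizontal gM F q)%MS ->
  bil (pull_metric q) u v = bil (gM q) u v.
Proof. exact: (bil_h_hor (@gs q) (@gp q) (@gNs (F q)) (@submersion_isom q)). Qed.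

Variable p : M.
Notation c := (chart_at p).
Notation d := (chart_at (F p)).
Notation b := (base p).
Notation O := (map_domain F c d).
Notation Fh := (map_rep F c d).
Notation T := (tangent_map F p).
Notation Gam := (christoffel_term gM p).
Notation GamN := (christoffel_term gN (F p)).
Notation J := (jacobian (map_rep F c d)).
Notation gNF := (bilin_rep d gN \o Fh).
Let ac : atlas c := chart_at_atlas p.
Let ad : atlas d := chart_at_atlas (F p).
Let oO : open O := open_map_domain sF (c := c) (d := d).
Let Ob : O b := base_map_domain F p.

(** The pullback metric written as a product of smooth matrices in the fixed charts; [bil_pull_rep]
    relates it to [pull_metric]. *)
Definition pull_rep (y : 'rV[R]_m) : 'M[R]_m := J y *m gNF y *m (J y)^T.

Lemma bil_pull_rep y u v : O y -> bil (pull_rep y) u v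
  = bil (pull_metric (of_coord c y)) (u *m tan_from c (of_coord c y))
      (v *m tan_from c (of_coord c y)).
Proof.
by move=> Oy; exact: (etrans (bil_pull _ _ _ _) (bil_map_rep sF gN u v ac ad Oy)).
Qed.

Lemma Ck_J k : Ck k O J.
Proof. by apply: Ck_jacobian => //; exact: (Ck_map_rep sF k.+1 ac ad). Qed.

Lemma Ck_gNF k : Ck k O gNF.
Proof.
apply: (Ck_comp_mx oO (@open_target _ _ _ d) _ (Ck_map_rep sF k ac ad)).
  by move=> y Oy; exact: map_rep_target.
exact: ((smooth_onE _ _).1 (hN.1 _ ad) k).
Qed.

Lemma Ck_pull_rep k : Ck k O pull_rep.
Proof.
exact: (Ck_mulmx oO (Ck_mulmx oO (Ck_J k) (Ck_gNF k)) (Ck_trmx oO (Ck_J k))).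
Qed.

Lemma Ck_metric_rep k : Ck k O (bilin_rep c gM).
Proof.
by apply: Ck_sub ((smooth_onE _ _).1 (hg.1 _ ac) k) => y [].
Qed.

Let dJ : differentiable J b := Ck_diff (Ck_J 0) Ob.

Variable J1 : 'rV[R]_m -> 'M[R]_(m, n).
Hypothesis J1E : forall x, 'D_x (jacobian (map_rep F (chart_at p) (chart_at (F p)))) (base p)
  = J1 x.

Let near_O (P : 'rV[R]_m -> Prop) (H : forall y, O y -> P y) :
  \forall y \near b, P y := near_open oO Ob H.

(** Both sides are second derivatives of F in coordinates, so this is Schwarz's theorem. *)
Lemma hessian_sym u v : u *m J1 v = v *m J1 u.
Proof.
have C1 := Ck_map_rep sF 1 ac ad.
have E x w : 'D_x (fun y => 'D_w Fh y) b = w *m J1 x.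
  have [_ D1] := derive_mulmx_cstl w x dJ.
  rewrite J1E in D1; rewrite -D1; apply: near_eq_derive; apply: near_O => y Oy.
  exact: deriveEjacobian (Ck_diff C1 Oy).
by rewrite -!E; exact: derive_sym_mx oO Ob C1.
Qed.

Lemma second_formC u v : second_form T J1 Gam GamN u v = second_form T J1 Gam GamN v u.
Proof.
have [G1 G1E] : exists G1 : 'rV[R]_m -> 'M[R]_m,
    forall x, 'D_x (bilin_rep (chart_at p) gM) (base p) = G1 x by eexists.
have [GN1 GN1E] : exists GN1 : 'rV[R]_n -> 'M[R]_n,
    forall x, 'D_x (bilin_rep (chart_at (F p)) gN) (base (F p)) = GN1 x by eexists.
have E1 := christoffel_termC hg G1E u v.
have E2 := christoffel_termC hN GN1E (u *m T) (v *m T).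
by rewrite /second_form (hessian_sym u v) E1 E2.
Qed.

Lemma second_formD x u v : second_form T J1 Gam GamN x (u + v)
  = second_form T J1 Gam GamN x u + second_form T J1 Gam GamN x v.
Proof.
have [G1 G1E] : exists G1 : 'rV[R]_m -> 'M[R]_m,
    forall x, 'D_x (bilin_rep (chart_at p) gM) (base p) = G1 x by eexists.
have [GN1 GN1E] : exists GN1 : 'rV[R]_n -> 'M[R]_n,
    forall x, 'D_x (bilin_rep (chart_at (F p)) gN) (base (F p)) = GN1 x by eexists.
have E1 := christoffel_term_linear hg G1E x 1 u v.
have E2 := christoffel_term_linear hN GN1E (x *m T) 1 (u *m T) (v *m T).
rewrite !scale1r in E1 E2.
rewrite /second_form E1 !mulmxDl E2.
move: (u *m J1 x) (v *m J1 x) (Gam x u *m T) (Gam x v *m T) (GamN _ _) (GamN _ _).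
by move=> A B C D E G; apply/rowP => i; rewrite !mxE; ring.
Qed.

Lemma derive_gNF (GN1 : 'rV[R]_n -> 'M[R]_n) x :
  (forall x, 'D_x (bilin_rep (chart_at (F p)) gN) (base (F p)) = GN1 x) ->
  'D_x gNF b = GN1 (x *m T).
Proof.
move=> GN1E; have dF := differentiable_map_rep sF ac ad Ob.
have FE := map_rep_base F p.
have dN : differentiable (bilin_rep d gN) (Fh b).
  by rewrite FE; exact: differentiable_metric_rep hN (F p).
rewrite (differentiable_comp_derive x dF dN) FE GN1E.
by have -> : 'D_x Fh b = x *m T by exact: deriveEjacobian dF.
Qed.

Lemma hor_second_form x u : (x <= horizontal gM F p)%MS ->
  second_form T J1 Gam GamN x u = 0.
Proof.
have [G1 G1E] : exists G1 : 'rV[R]_m -> 'M[R]_m,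
    forall x, 'D_x (bilin_rep (chart_at p) gM) (base p) = G1 x by eexists.
have [F1 F1E] : exists F1 : 'rV[R]_m -> 'M[R]_m,
    forall x, 'D_x (endo_rep (chart_at p) phi) (base p) = F1 x by eexists.
have [X1 X1E] : exists X1 : 'rV[R]_m -> 'rV[R]_m,
    forall x, 'D_x (vec_rep (chart_at p) xi) (base p) = X1 x by eexists.
have [H1 H1E] : exists H1 : 'rV[R]_m -> 'M[R]_m,
    forall x, 'D_x pull_rep (base p) = H1 x by eexists.
have [GN0 GN0E] : exists GN1 : 'rV[R]_n -> 'M[R]_n,
    forall x, 'D_x (bilin_rep (chart_at (F p)) gN) (base (F p)) = GN1 x by eexists.
have GN1E x0 := derive_gNF x0 GN0E.
have [GN1 GN1D] : exists GN1 : 'rV[R]_m -> 'M[R]_n, forall x, GN0 (x *m T) = GN1 x by eexists.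
have {}GN1E x0 : 'D_x0 gNF b = GN1 x0 := etrans (GN1E x0) (GN1D x0).
have glb : bilin_rep c gM b = gM p := bilin_rep_base gM p.
have flb : endo_rep c phi b = phi p := endo_rep_base phi p.
have xlb : vec_rep c xi b = xi p := vec_rep_base xi p.
have Jfb : J b = T := erefl.
have gNFb : gNF b = gN (F p).
  exact: etrans (congr1 (bilin_rep d gN) (map_rep_base F p)) (bilin_rep_base gN (F p)).
have hlb : pull_rep b = pull_metric p.
  exact: (congr1 (fun A => T *m A *m T^T) gNFb).
have dgO y (Oy : O y) : differentiable (bilin_rep c gM) y := Ck_diff (Ck_metric_rep 0) Oy.
have dhO y (Oy : O y) : differentiable pull_rep y := Ck_diff (Ck_pull_rep 0) Oy.
have dG : differentiable gNF b := Ck_diff (Ck_gNF 0) Ob.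
have df := differentiable_endo_rep hM p.
have dx := differentiable_xi_rep hM p.
have [parp parx] := cosymplectic_parallel hM p.
have par_phi x0 u0 : u0 *m F1 x0 + Gam x0 (u0 *m phi p) - Gam x0 u0 *m phi p = 0.
  by have := parp x0 u0; rewrite F1E.
have par_xi x0 : X1 x0 + Gam x0 (xi p) = 0 by have := parx x0; rewrite X1E.
have bil_hl y u0 v0 : bil (pull_rep y) u0 v0 = bil (gNF y) (u0 *m J y) (v0 *m J y).
  exact: bil_pull.
have hl_phi y u0 v0 : O y -> bil (pull_rep y) (u0 *m endo_rep c phi y) v0
    - bil (pull_rep y) u0 (v0 *m endo_rep c phi y)
    = bil (bilin_rep c gM y) (u0 *m endo_rep c phi y) v0.
  move=> Oy; have E1 := endo_rep_mul phi u0 Oy.1; have E2 := endo_rep_mul phi v0 Oy.1.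
  set q := of_coord c y in E1 E2 *; set S := tan_from c q in E1 E2 *.
  have B1 := etrans (bil_pull_rep (u0 *m endo_rep c phi y) v0 Oy)
    (congr1 (fun a => bil (pull_metric q) a (v0 *m S)) E1).
  have B2 := etrans (bil_pull_rep u0 (v0 *m endo_rep c phi y) Oy)
    (congr1 (bil (pull_metric q) (u0 *m S)) E2).
  have B3 := etrans (bil_bilin_rep c gM y (u0 *m endo_rep c phi y) v0)
    (congr1 (fun a => bil (gM q) a (v0 *m S)) E1).
  have B4 := pull_phi q (u0 *m S) (v0 *m S).
  exact: etrans (f_equal2 (fun s t => s - t) B1 B2) (etrans B4 (esym B3)).
have hl_xi y u0 : O y -> bil (pull_rep y) u0 (vec_rep c xi y)
    = bil (bilin_rep c gM y) u0 (vec_rep c xi y).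
  move=> Oy; have E1 := vec_rep_from xi ac Oy.1.
  set q := of_coord c y in E1 *; set S := tan_from c q in E1 *.
  have B1 := etrans (bil_pull_rep u0 (vec_rep c xi y) Oy)
    (congr1 (bil (pull_metric q) (u0 *m S)) E1).
  have B2 := etrans (bil_bilin_rep c gM y u0 (vec_rep c xi y))
    (congr1 (bil (gM q) (u0 *m S)) E1).
  exact: etrans B1 (etrans (pull_xi q (u0 *m S)) (esym B2)).
have hl_le y u0 : O y -> bil (pull_rep y) u0 u0 <= bil (bilin_rep c gM y) u0 u0.
  by move=> Oy; rewrite (bil_pull_rep _ _ Oy) bil_bilin_rep; exact: pull_le.
have met := derive_metric hg G1E.
have metN x0 u0 v0 : bil (GN1 x0) u0 v0 = bil (gN (F p)) (GamN (x0 *m T) u0) v0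
    + bil (gN (F p)) u0 (GamN (x0 *m T) v0).
  by rewrite -GN1D; exact: (derive_metric hN GN0E (x0 *m T) u0 v0).
have Gaml := christoffel_term_linear hg G1E.
have Gaml1 := christoffel_term_linearl hg G1E.
have hor_add (u0 v0 : 'rV[R]_m) : (u0 <= horizontal gM F p)%MS -> (v0 <= horizontal gM F p)%MS ->
  ((u0 + v0)%R <= horizontal gM F p)%MS by exact: addmx_sub.
have KE := derive_pullE Ob dhO dJ dG Jfb gNFb hlb bil_hl H1E J1E GN1E Gam metN.
have Kphi := derive_pull_phi oO Ob dgO dhO df glb flb hlb hl_phi G1E F1E H1E met par_phi.
have Kxi := derive_pull_xi oO Ob dgO dhO dx glb xlb hlb hl_xi G1E X1E H1E met par_xi.
have Khor := derive_pull_hor oO Ob dgO dhO dJ dG glb Jfb gNFb hlb bil_hl hl_le (@gs p)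
  (@gNs (F p)) G1E H1E J1E GN1E Gaml met metN hor_add (@pull_hor p).
have Kl1 := derive_pull_linearl Ob dhO (pull_metric p) H1E Gaml1.
have Kl3 := derive_pull_linearr (pull_metric p) H1 Gaml.
move: x u; apply: (@submersion_algebra R _ _ (fun u => (u <= vertical F p)%MS)
  (fun u => (u <= horizontal gM F p)%MS) (fun u => u *m T) (fun u => u *m phi p) (xi p)
  (bil (gN (F p))) (derive_pull (pull_metric p) H1 Gam) (second_form T J1 Gam GamN)).
- exact: gNs.
- by move=> w; exact: bil0l.
- by move=> w w' y; exact: bilDl.
- by move=> w; exact: (hor_nondeg (@gp p) (@gNp (F p)) (submersion_rank p)).
- by move=> u0 /verE.
- exact: second_formD.
- exact: second_formC.
- by move=> a x0 x1 u0 v0; exact: Kl1.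
- by move=> x0 a u0 v0 y; exact: Kl3.
- exact: KE.
- exact: Kphi.
- exact: Kxi.
- by move=> x0 y z hy hz; exact: Khor hy hz.
- exact: (ver_hor_decomp T (@gp p)).
- by move=> z hz; exact: (hor_split (hsplit p) hz).
- by move=> w hw; exact: (hor_phi (hsplit p) hw).
- exact: (hor_xi (hsplit p)).
Qed.

Lemma differentiable_vec_rep (Y : vector_field M) : smooth_vector_field Y ->
  differentiable (vec_rep (chart_at p) Y) (base p).
Proof. by move=> sY; exact: (sY _ ac [::] _ (base_target p)). Qed.

Lemma derive_along_push Y x : smooth_vector_field Y ->
  'D_x (along_rep F (chart_at p) (chart_at (F p)) (push F Y)) (base p)
  = 'D_x (vec_rep (chart_at p) Y) (base p) *m T + Y p *m J1 x.
Proof.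
move=> sY; have dY := differentiable_vec_rep sY.
have D1 := derive_mulmx x dY dJ; rewrite J1E vec_rep_base in D1.
apply: etrans _ D1; apply: near_eq_derive; apply: near_O => y Oy.
exact: along_rep_push.
Qed.

(** The derivative of the components of [Y] occurs in both connections and cancels. What is left
    depends only on X p and Y p, so either field may be replaced by one with the same value at p. *)
Lemma second_fundamental_formE X Y : smooth_vector_field Y ->
  second_fundamental_form gM gN F X Y p = second_form T J1 Gam GamN (X p) (Y p).
Proof.
move=> sY; rewrite /second_fundamental_form /pullback_connection (derive_along_push _ sY).
rewrite /second_form /push /levi_civita mulmxDl.
move: ('D_(X p) _ _ *m T) (Y p *m J1 (X p)) (GamN _ _) (Gam _ _ *m T) => A B C D.
by apply/rowP => i; rewrite !mxE; ring.
Qed.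

Lemma exists_vertical_field (u : 'rV[R]_m) : (u <= vertical F p)%MS ->
  exists X : vector_field M, [/\ smooth_vector_field X, X p = u &
    forall q, X q *m tangent_map F q = 0].
Proof.
move=> /verE uT.
pose gl := bilin_rep c gM.
have gu q : gM q \in unitmx by apply: posdef_unit; exact: gp.
(* This normalisation makes the field equal [u] at p, where the term with h vanishes because [u] is
   vertical. *)
pose u' := (\det (gM p))^-1 *: u.
pose w (y : 'rV[R]_m) : 'rV[R]_m :=
  u' *m (\det (gl y) *: 1%:M + (-1) *: (pull_rep y *m \adj (gl y))).
have Cw k : Ck k O w.
  have Cg := Ck_metric_rep k.
  apply: (Ck_mulmx oO (Ck_cst _ _ _)); apply: (CkD oO).
    exact: (Ck_scalemx oO (Ck_det oO Cg) (Ck_cst _ _ _)).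
  apply: (Ck_scalemx oO (Ck_cst _ _ _)).
  exact: (Ck_mulmx oO (Ck_pull_rep k) (Ck_adjugate oO Cg)).
have Oc : O `<=` target c by move=> y [].
have [X [f [sX fb _ Xrep X0]]] := exists_extension ac oO Oc Ob Cw.
exists X; split; first exact: sX.
  rewrite -(vec_rep_base X) (Xrep _ Ob) fb scale1r /w.
  have -> : gl b = gM p by exact: bilin_rep_base.
  have uh : u' *m pull_rep b = 0.
    by rewrite /pull_rep !mulmxA -scalemxAl uT scaler0 !mul0mx.
  rewrite mulmxDr -scalemxAr mulmx1 -scalemxAr mulmxA uh mul0mx scaler0 addr0.
  rewrite /u' scalerA mulfV ?scale1r//.
  by have := gu p; rewrite unitmxE unitfE.
move=> q; have [[cq Oq]|/X0 ->] := pselect (source c q /\ O (to_coord c q)); last first.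
  by rewrite mul0mx.
set y := to_coord c q in Oq.
have qy : of_coord c y = q := to_coordK cq.
have XE := vec_rep_from X ac (Oc _ Oq); rewrite qy (Xrep _ Oq) in XE.
rewrite -XE -scalemxAl -scalemxAl.
suff -> : w y *m tan_from c q *m tangent_map F q = 0 by rewrite scaler0.
have ST := tan_fromK ac cq; have TS := tan_toK ac cq.
have hlE : pull_rep y = tan_from c q *m pull_metric q *m (tan_from c q)^T.
  apply: bil_eq => s t; rewrite (bil_pull_rep _ _ Oq) qy.
  exact: esym (bil_pull _ _ _ _).
have glE : gl y = tan_from c q *m gM q *m (tan_from c q)^T.
  by rewrite /gl /bilin_rep /= qy.
have vp := vertical_projection (@gs q) (@gp q) (@gNs (F q)) (@submersion_isom q)
  (u' *m tan_from c q).
rewrite -/(pull_metric q) in vp.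
rewrite /w hlE glE; move: ST TS vp (gu q).
move: (tan_from c q) (tan_to c q) (pull_metric q) (gM q) (tangent_map F q).
move=> S S' h g A ST TS vp ug.
have uS : S \in unitmx by case/mulmx1_unit: ST.
set G := S *m g *m S^T.
have uG : G \in unitmx by rewrite !unitmx_mul uS ug unitmx_tr uS.
(* The adjugate in the chart [c] is brought to the frame at q, to show that the field is det G times
   the vertical projection of u' there. *)
have adjE : \adj G *m S = \det G *: (S'^T *m invmx g).
  apply: (can_inj (mulKmx uG)).
  rewrite mulmxA mul_mx_adj mul_scalar_mx -scalemxAr; congr (_ *: _).
  by rewrite /G mulmxA -(mulmxA _ S^T) -trmx_mul TS trmx1 mulmx1 mulmxK.
have E : (\det G *: 1%:M + -1 *: (S *m h *m S^T *m \adj G)) *m S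
    = \det G *: (S - S *m h *m invmx g).
  rewrite mulmxDl -scalemxAl mul1mx scaleN1r mulNmx -(mulmxA _ (\adj G)) adjE.
  rewrite -scalemxAr scalerBr; congr (_ - _ *: _).
  by rewrite mulmxA -(mulmxA _ S^T) -trmx_mul TS trmx1 mulmx1.
rewrite -(mulmxA u') E -scalemxAr -scalemxAl mulmxBr !mulmxA.
by rewrite vp scaler0.
Qed.

(** F_* Y vanishes on the fibre through p, a level set of F, and [v] is tangent to it. The right
    inverse asked by [derive_level_set] is the pseudo-inverse of the surjective differential. *)
Lemma derive_along_fiber Y v : smooth_vector_field Y -> tangent_to_fiber F (F p) Y ->
  v *m T = 0 ->
  'D_v (along_rep F (chart_at p) (chart_at (F p)) (push F Y)) (base p) = 0.
Proof.
move=> sY tY vT; have dY := differentiable_vec_rep sY.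
have dF := differentiable_map_rep sF ac ad Ob.
have nearE : \forall y \near b,
    vec_rep c Y y *m J y = along_rep F c d (push F Y) y.
  by apply: near_O => y Oy; apply/esym; exact: along_rep_push.
apply: (@derive_level_set _ _ _ _ Fh _ O (pinvmx T) b v oO Ob (Ck_map_rep sF 1 ac ad)).
- move=> w; rewrite (deriveEjacobian _ dF) -[jacobian _ _]/T -mulmxA mulVpmx ?mulmx1//.
  by rewrite /row_full submersion_rank.
- exact: differentiable_near nearE (differentiable_mulmx dY dJ).
- move=> y Oy yb.
  have Fy : F (of_coord c y) = F p.
    have := of_map_rep Oy; rewrite yb (of_map_rep Ob) of_base => E.
    exact: esym E.
  rewrite /along_rep /push /=.
  by have /verE -> := tY _ Fy; rewrite mul0mx.
- by rewrite (deriveEjacobian _ dF).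
Qed.

End Submersion.

Theorem theorem17 (R : realType) (k n : nat)
  (M : manifold R k.*2.+1) (N : manifold R n)
  (phi : endo_field M) (xi : vector_field M) (eta : one_form M)
  (gM : bilin_field M) (gN : bilin_field N) (F : M -> N)
  (hM : cosymplectic phi xi eta gM)
  (hN : riemannian_metric gN)
  (hF : riemannian_submersion gM gN F)
  (hsplit : forall p : M,
     (horizontal gM F p == vertical F p *m phi p + xi p)%MS /\
     mxdirect (vertical F p *m phi p + xi p)) :
  totally_geodesic_map gM gN F <-> totally_geodesic_fibers gM F.
Proof.
have hs p := (hsplit p).1.
have hg := cosymplectic_metric hM.
have GamN0 p v : christoffel_term gN (F p) v 0 = 0.
  have [GN1 GN1E] : exists GN1 : 'rV[R]_n -> 'M[R]_n,
    forall x, 'D_x (bilin_rep (chart_at (F p)) gN) (base (F p)) = GN1 x by eexists.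
  exact: (@christoffel_term0 _ _ _ _ hN _ _ GN1E).
split=> [geo q X Y sX sY tX tY p Fp|fib X Y sX sY p].
  rewrite -Fp in tX tY; apply/verE.
  have XT : X p *m tangent_map F p = 0 by apply/verE; exact: tX.
  have YT : Y p *m tangent_map F p = 0 by apply/verE; exact: tY.
  have := geo X Y sX sY p.
  rewrite /second_fundamental_form /pullback_connection.
  rewrite (derive_along_fiber hF sY tY XT) /push YT GamN0 addr0 sub0r => /eqP.
  by rewrite oppr_eq0 => /eqP.
have [J1 J1E] : exists J1 : 'rV[R]_(k.*2.+1) -> 'M[R]_(k.*2.+1, n), forall x,
  'D_x (jacobian (map_rep F (chart_at p) (chart_at (F p)))) (base p) = J1 x by eexists.
rewrite (second_fundamental_formE hF J1E X sY).
have gp := @riem_pos _ _ _ _ hg p.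
have hor0 := hor_second_form hM hN hF hs J1E.
have sfC := second_formC hM hN hF J1E.
have sfD x u v : second_form (tangent_map F p) J1 (christoffel_term gM p)
    (christoffel_term gN (F p)) x (u + v)
  = second_form (tangent_map F p) J1 (christoffel_term gM p) (christoffel_term gN (F p)) x u
    + second_form (tangent_map F p) J1 (christoffel_term gM p) (christoffel_term gN (F p)) x v.
  by apply: second_formD; eassumption.
(* Both arguments are split; symmetry brings each horizontal part into the first slot, where it
   contributes 0. *)
have [a [b [-> av bh]]] := ver_hor_decomp (tangent_map F p) gp (Y p).
rewrite sfD [X in _ + X]sfC (hor0 _ _ bh) addr0.
have [a' [b' [-> av' bh']]] := ver_hor_decomp (tangent_map F p) gp (X p).
rewrite sfC sfD [X in _ + X]sfC (hor0 _ _ bh') addr0 sfC.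
have [A [sA Ap Av]] := exists_vertical_field hM hN hF av'.
have [B [sB Bp Bv]] := exists_vertical_field hM hN hF av.
have tA : tangent_to_fiber F (F p) A by move=> q _; apply/verE.
have tB : tangent_to_fiber F (F p) B by move=> q _; apply/verE.
have /verE LC := fib (F p) A B sA sB tA tB p erefl.
(* By tensoriality the vertical parts at p may be taken as values of the fields [A] and [B], to
   which the hypothesis on fibres applies. *)
rewrite -Ap -Bp -(second_fundamental_formE hF J1E A sB).
have pB : push F B p = 0 := Bv p.
rewrite /second_fundamental_form /pullback_connection pB GamN0.
by rewrite (derive_along_fiber hF sB tB (Av p)) /push LC subr0 addr0.
Qed.
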